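(* Let $D=(\alpha,\beta)_{\mathbb Q}$ be a quaternion division algebra over $\mathbb Q$ and let $G=\{x\in D^*: N(x)=1\}$ be its norm-1 group. Then exactly one of the following holds. (a) $-1$ has a square root in $D$, and for all but finitely many primes $p$, the action of $G$ on the tree $\Delta_p$ is strongly transitive with respect to some apartment system. (b) $-1$ does not have a square root in $D$, and for all but finitely many primes $p$, the action of $G$ on $\Delta_p$ is Weyl transitive but is not strongly transitive with respect to any apartment system.
   Context: For nonzero $\alpha,\beta\in\mathbb Q$, $(\alpha,\beta)_{\mathbb Q}$ is the 4-dimensional associative $\mathbb Q$-algebra with basis $1,e_2,e_3,e_4$, where $e_2^2=\alpha$, $e_3^2=\beta$, $e_2e_3=-e_3e_2=e_4$. For $x=x_1+x_2e_2+x_3e_3+x_4e_4$, $\bar x=x_1-x_2e_2-x_3e_3-x_4e_4$ and $N(x)=x\bar x=x_1^2-\alpha x_2^2-\beta x_3^2+\alpha\beta x_4^2$. For a prime $p$, $D_p=D\otimes_{\mathbb Q}\mathbb Q_p=(\alpha,\beta)_{\mathbb Q_p}$ and $G_p$ is its norm-1 group; for all but finitely many $p$, $D_p\cong M_2(\mathbb Q_p)$, and choosing such an isomorphism identifies $G_p$ with $\mathrm{SL}_2(\mathbb Q_p)$, so $G\subset G_p$ acts on $\Delta_p$ (different choices give conjugate actions). $\Delta_p$ is the Bruhat–Tits tree of $\mathrm{SL}_2(\mathbb Q_p)$: vertices are homothety classes of $\mathbb Z_p$-lattices in $\mathbb Q_p^2$, two classes adjacent if they have representatives $L\supset L'\supset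 pL$; it is a building whose chambers are the edges and whose Weyl group $W$ is the infinite dihedral group; $\mathrm{SL}_2(\mathbb Q_p)$ acts by type-preserving automorphisms. Building terminology: $\delta:\mathcal C\times\mathcal C\to W$ is the Weyl distance on the set $\mathcal C$ of chambers; the complete apartment system is the set of all apartments (for the tree: all bi-infinite lines); an apartment system is a subset $\mathcal A$ of the complete apartment system such that any two chambers lie in a common member of $\mathcal A$. A type-preserving action of $G$ is strongly transitive with respect to a $G$-invariant apartment system $\mathcal A$ if $G$ is transitive on pairs $(\Sigma,C)$ with $\Sigma\in\mathcal A$ and $C$ a chamber of $\Sigma$; it is Weyl transitive if for each $w\in W$, $G$ is transitive on $\{(C,C')\in\mathcal C\times\mathcal C:\delta(C,C')=w\}$. *)

(* Defs.v *)
From HB Require Import structures.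
From mathcomp Require Import all_boot all_order all_algebra.
Set Implicit Arguments. Unset Strict Implicit. Unset Printing Implicit Defensive.
Import Order.TTheory GRing.Theory Num.Theory.
Local Open Scope ring_scope.

(* x = x1 + x2 e2 + x3 e3 + x4 e4 *)
Record quat (R : Type) := Quat { q1 : R; q2 : R; q3 : R; q4 : R }.

Section Quat.
Variable R : comNzRingType.

Definition qone : quat R := Quat 1 0 0 0.
Definition qopp (x : quat R) : quat R := Quat (- q1 x) (- q2 x) (- q3 x) (- q4 x).
Definition qadd (x y : quat R) : quat R :=
  Quat (q1 x + q1 y) (q2 x + q2 y) (q3 x + q3 y) (q4 x + q4 y).
Definition qscale (c : R) (x : quat R) : quat R :=
  Quat (c * q1 x) (c * q2 x) (c * q3 x) (c * q4 x).

(* multiplication with e2^2 = a, e3^2 = b, e2 e3 = - e3 e2 = e4 *)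
Definition qmul (a b : R) (x y : quat R) : quat R :=
  Quat (q1 x * q1 y + a * q2 x * q2 y + b * q3 x * q3 y - a * b * q4 x * q4 y)
       (q1 x * q2 y + q2 x * q1 y - b * q3 x * q4 y + b * q4 x * q3 y)
       (q1 x * q3 y + q3 x * q1 y + a * q2 x * q4 y - a * q4 x * q2 y)
       (q1 x * q4 y + q4 x * q1 y + q2 x * q3 y - q3 x * q2 y).

(* reduced norm N(x) = x xbar *)
Definition qnorm (a b : R) (x : quat R) : R :=
  q1 x ^+ 2 - a * q2 x ^+ 2 - b * q3 x ^+ 2 + a * b * q4 x ^+ 2.
End Quat.

Definition qmap (R S : Type) (f : R -> S) (x : quat R) : quat S :=
  Quat (f (q1 x)) (f (q2 x)) (f (q3 x)) (f (q4 x)).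

Definition is_division (a b : rat) : Prop :=
  forall x : quat rat, x <> Quat 0 0 0 0 ->
    exists y, qmul a b x y = qone rat /\ qmul a b y x = qone rat.

Definition normone (a b : rat) (x : quat rat) : Prop := qnorm a b x = 1.

Definition sqrt_minus_one (a b : rat) : Prop :=
  exists x : quat rat, qmul a b x x = qopp (qone rat).

Definition padic_abs (p : nat) (q : rat) : rat :=
  if q == 0 then 0
  else (p%:R : rat) ^ ((logn p (absz (denq q)))%:Z - (logn p (absz (numq q)))%:Z).

(* (K, iota, abs) is a completion of Q w.r.t. |.|_p, i.e. a model of Q_p
   (unique up to unique isometric isomorphism) *)
Definition is_Qp (p : nat) (K : fieldType) (iota : {rmorphism rat -> K})
    (abs : K -> rat) : Prop :=
  [/\ (forall x, 0 <= abs x),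
      (forall x, abs x = 0 <-> x = 0),
      (forall x y, abs (x * y) = abs x * abs y) &
      (forall x y, abs (x + y) <= Num.max (abs x) (abs y))] /\
  [/\ (forall q, abs (iota q) = padic_abs p q),
      (forall x (e : rat), 0 < e -> exists q, abs (x - iota q) < e) &
      (forall u : nat -> K,
         (forall e : rat, 0 < e -> exists N, forall m n,
              (N <= m)%N -> (N <= n)%N -> abs (u m - u n) < e) ->
         exists l, forall e : rat, 0 < e -> exists N, forall n,
              (N <= n)%N -> abs (u n - l) < e)].

Definition splitting_iso (a b : rat) (K : fieldType) (iota : {rmorphism rat -> K})
    (phi : quat K -> 'M[K]_2) : Prop :=
  [/\ (forall x y, phi (qadd x y) = phi x + phi y),
      (forall c x, phi (qscale c x) = c *: phi x),
      (forall x y, phi (qmul (iota a) (iota b) x y) = phi x *m phi y),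
      phi (qone K) = 1%:M &
      bijective phi].

Section Tree.
Variables (p : nat) (K : fieldType) (abs : K -> rat).

Definition vsetT := 'cV[K]_2 -> Prop.

Definition lattice_of (g : 'M[K]_2) : vsetT :=
  fun w => exists u : 'cV[K]_2, (forall i, abs (u i 0) <= 1) /\ w = g *m u.

Definition is_lattice (L : vsetT) : Prop :=
  exists g : 'M[K]_2, g \in unitmx /\ forall w, L w <-> lattice_of g w.

Definition lscale (c : K) (L : vsetT) : vsetT :=
  fun w => exists w0, L w0 /\ w = c *: w0.

Definition homothetic (L L' : vsetT) : Prop :=
  exists c : K, c != 0 /\ forall w, L' w <-> lscale c L w.

Definition lsub (L L' : vsetT) : Prop := forall w, L w -> L' w.

Definition adjv (L L' : vsetT) : Prop :=
  [/\ is_lattice L, is_lattice L', ~ homothetic L L' &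
      exists L1 L1', [/\ homothetic L L1, homothetic L' L1',
                         lsub L1' L1 & lsub (lscale (p%:R) L1) L1']].

(* type of a vertex: [g Z_p^2] has type 0 iff v_p(det g) is even *)
Definition type0 (L : vsetT) : Prop :=
  exists g : 'M[K]_2, [/\ g \in unitmx, abs (\det g) = 1 & homothetic (lattice_of g) L].

(* chambers = edges, written as (type-0 vertex, type-1 vertex) *)
Definition chamber := (vsetT * vsetT)%type.

Definition is_chamber (C : chamber) : Prop :=
  [/\ type0 C.1, ~ type0 C.2 & adjv C.1 C.2].

Definition ch_eq (C D : chamber) : Prop :=
  homothetic C.1 D.1 /\ homothetic C.2 D.2.

(* C and D are s_i-adjacent (i = false : s_0, i = true : s_1):
   distinct chambers sharing the panel of cotype i, i.e. the vertex of type 1-i *)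
Definition cadj (i : bool) (C D : chamber) : Prop :=
  [/\ is_chamber C, is_chamber D, ~ ch_eq C D &
      if i then homothetic C.1 D.1 else homothetic C.2 D.2].

Definition gallery (C D : chamber) (w : seq bool) : Prop :=
  exists c : nat -> chamber,
    [/\ ch_eq (c 0%N) C, ch_eq (c (size w)) D &
        forall k, (k < size w)%N -> cadj (nth false w k) (c k) (c k.+1)].

(* Weyl distance: delta(C,D) is the element of the infinite dihedral group
   W = <s_0, s_1> represented by the (reduced) type word of a minimal gallery *)
Definition weyl_dist (C D : chamber) (w : seq bool) : Prop :=
  gallery C D w /\ forall w', gallery C D w' -> (size w <= size w')%N.

(* apartments: bi-infinite lines, given as their sets of chambers *)
Definition apartment (S : chamber -> Prop) : Prop :=
  exists f : int -> vsetT,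
    [/\ (forall k, adjv (f k) (f (k + 1))),
        (forall k l, homothetic (f k) (f l) -> k = l) &
        forall C, S C <-> (is_chamber C /\ exists k,
             (homothetic C.1 (f k) /\ homothetic C.2 (f (k + 1))) \/
             (homothetic C.2 (f k) /\ homothetic C.1 (f (k + 1))))].

Definition apartment_system (A : (chamber -> Prop) -> Prop) : Prop :=
  (forall S, A S -> apartment S) /\
  (forall C D, is_chamber C -> is_chamber D -> exists S, [/\ A S, S C & S D]).

End Tree.

Section Action.
Variables (a b : rat) (p : nat) (K : fieldType) (iota : {rmorphism rat -> K})
  (abs : K -> rat) (phi : quat K -> 'M[K]_2).

Definition gmat (x : quat rat) : 'M[K]_2 := phi (qmap iota x).

Definition actL (x : quat rat) (L : vsetT K) : vsetT K :=
  fun w => exists w0, L w0 /\ w = gmat x *m w0.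

Definition actC (x : quat rat) (C : chamber K) : chamber K :=
  (actL x C.1, actL x C.2).

Definition weyl_transitive : Prop :=
  forall (w : seq bool) (C1 D1 C2 D2 : chamber K),
    is_chamber p abs C1 -> is_chamber p abs D1 ->
    is_chamber p abs C2 -> is_chamber p abs D2 ->
    weyl_dist p abs C1 D1 w -> weyl_dist p abs C2 D2 w ->
    exists x, [/\ normone a b x, ch_eq (actC x C1) C2 & ch_eq (actC x D1) D2].

Definition G_invariant (A : (chamber K -> Prop) -> Prop) : Prop :=
  forall x S, normone a b x -> A S ->
    exists S', A S' /\ forall C, S C <-> S' (actC x C).

Definition strongly_transitive_wrt (A : (chamber K -> Prop) -> Prop) : Prop :=
  forall S1 C1 S2 C2, A S1 -> S1 C1 -> A S2 -> S2 C2 ->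
    exists x, [/\ normone a b x,
                  (forall C, S1 C <-> S2 (actC x C)) & ch_eq (actC x C1) C2].

Definition strongly_transitive_some : Prop :=
  exists A, [/\ apartment_system p abs A, G_invariant A & strongly_transitive_wrt A].

End Action.

Definition almost_all_p (a b : rat)
    (P : forall (p : nat) (K : fieldType), {rmorphism rat -> K} -> (K -> rat) ->
           (quat K -> 'M[K]_2) -> Prop) : Prop :=
  exists S : seq nat, forall p : nat, prime p -> p \notin S ->
    forall (K : fieldType) (iota : {rmorphism rat -> K}) (abs : K -> rat),
      is_Qp p iota abs ->
      (exists phi, splitting_iso a b iota phi) /\
      (forall phi, splitting_iso a b iota phi -> P p K iota abs phi).

(* Main.v *)
(* Weak approximation: every [g] in [SL_2(Q_p)] with [tr g <> -2] equals [(1 + g)^2 / N(1 + g)],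
   so replacing [1 + g] by a nearby rational quaternion shows that [G] is dense, and elements
   of [G] can be prescribed on finitely many vertices.  As [SL_2(Q_p)] is Weyl transitive, so
   is [G].
   If [G] is strongly transitive for some apartments, some [x] in [G] reflects a line about a
   vertex; then [tr x] is divisible by every power of [p], so [tr x = 0] and [x^2 = -1].
   Conversely, let [i^2 = -1] and let [j] anticommute with [i], [j^2 = c].  The elements
   [y = s j + t i j] satisfy [y^2 = c (s^2 + t^2)], which can be made a unit square in [Q_p];
   then [Q(y)] splits at [p], [i] reflects the apartment of this torus, and a norm-one element
   [z / zbar] of [Q(y)] translates it.  The [G]-translates of this single apartment form the
   required system: density makes any two chambers lie in one of them. *)
Require Import Defs.
From HB Require Import structures.
From mathcomp Require Import all_boot all_order all_algebra.
From mathcomp Require Import zify ring lra.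
From Stdlib Require Import Classical_Prop.
Set Implicit Arguments. Unset Strict Implicit. Unset Printing Implicit Defensive.
Import Order.TTheory GRing.Theory Num.Theory.
Local Open Scope ring_scope.

(** * Two-by-two matrices *)

(** Density controls an element of [G] on finitely many vertices only. This is enough for Weyl
    transitivity and for finding an apartment through two given chambers, but not for the stabiliser
    of an entire apartment, which imposes infinitely many conditions. The translation and the
    reflection of the chosen line must therefore be exact elements of [G]. Hence the generator of
    the torus is rational and only its eigenvalue [r] is p-adic: [c (x^2 + y^2) = r^2] is solved
    with [x] and [y] rational, because the error of a solution modulo [p] can be absorbed into [r]
    by Hensel's lemma. This works for [p] odd and [c] a p-adic unit; the same argument for
    [a x^2 + b y^2 = r^2] splits the algebra, and these conditions give the finite set of excluded
    primes. Translating by exactly 2, the smallest shift that preserves types, makes the elements of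
    [G] that stabilise the line transitive on its chambers once the reflection is added. *)

Section TwoByTwo.
Variable R : comNzRingType.

Definition mx2 (x y z w : R) : 'M[R]_2 :=
  \matrix_(i, j) if i == 0 then if j == 0 then x else y
                 else if j == 0 then z else w.

Lemma ord2P (P : 'I_2 -> Prop) : P 0 -> P 1 -> forall i, P i.
Proof.
move=> P0 P1 [[|[|//]] i]; first by rewrite (_ : Ordinal i = 0) //; apply/val_inj.
by rewrite (_ : Ordinal i = 1) //; apply/val_inj.
Qed.

Lemma eq_mx2 (A B : 'M[R]_2) :
  A 0 0 = B 0 0 -> A 0 1 = B 0 1 -> A 1 0 = B 1 0 -> A 1 1 = B 1 1 -> A = B.
Proof. by move=> *; apply/matrixP; apply: ord2P; apply: ord2P. Qed.

Lemma mx2_00 x y z w : mx2 x y z w 0 0 = x. Proof. by rewrite mxE. Qed.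
Lemma mx2_01 x y z w : mx2 x y z w 0 1 = y. Proof. by rewrite mxE. Qed.
Lemma mx2_10 x y z w : mx2 x y z w 1 0 = z. Proof. by rewrite mxE. Qed.
Lemma mx2_11 x y z w : mx2 x y z w 1 1 = w. Proof. by rewrite mxE. Qed.
Definition mx2E := (mx2_00, mx2_01, mx2_10, mx2_11).

Lemma mx2_eta (A : 'M[R]_2) : A = mx2 (A 0 0) (A 0 1) (A 1 0) (A 1 1).
Proof. by apply: eq_mx2; rewrite mx2E. Qed.

Variant mx2_spec : 'M[R]_2 -> Type := Mx2Spec x y z w : mx2_spec (mx2 x y z w).
Lemma mx2P A : mx2_spec A. Proof. by rewrite [A]mx2_eta. Qed.

Lemma mx2_mul x y z w x' y' z' w' :
  mx2 x y z w *m mx2 x' y' z' w' =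
  mx2 (x * x' + y * z') (x * y' + y * w') (z * x' + w * z') (z * y' + w * w').
Proof. by apply: eq_mx2; rewrite !mx2E mxE !big_ord_recl big_ord0 /= addr0 !mxE. Qed.

Lemma mx2_add x y z w x' y' z' w' :
  mx2 x y z w + mx2 x' y' z' w' = mx2 (x + x') (y + y') (z + z') (w + w').
Proof. by apply: eq_mx2; rewrite mxE !mx2E. Qed.

Lemma mx2_opp x y z w : - mx2 x y z w = mx2 (- x) (- y) (- z) (- w).
Proof. by apply: eq_mx2; rewrite mxE !mx2E. Qed.

Lemma mx2_scale c x y z w : c *: mx2 x y z w = mx2 (c * x) (c * y) (c * z) (c * w).
Proof. by apply: eq_mx2; rewrite mxE !mx2E. Qed.

Lemma mx2_scalar c : c%:M = mx2 c 0 0 c.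
Proof. by apply: eq_mx2; rewrite mxE !mx2E. Qed.

Lemma det_mx2 x y z w : \det (mx2 x y z w) = x * w - y * z.
Proof.
rewrite (expand_det_row _ 0) !big_ord_recl big_ord0 /cofactor !det_mx11 !mxE /=.
by rewrite addr0 expr0 mul1r expr1 mulN1r mulrN.
Qed.

Lemma tr_mx2 x y z w : \tr (mx2 x y z w) = x + w.
Proof. by rewrite /mxtrace !big_ord_recl big_ord0 /= addr0 !mxE. Qed.

Lemma mx2_inj x y z w x' y' z' w' :
  mx2 x y z w = mx2 x' y' z' w' -> [/\ x = x', y = y', z = z' & w = w'].
Proof.
by move=> e; split; [move/matrixP/(_ 0 0): e | move/matrixP/(_ 0 1): e
                    |move/matrixP/(_ 1 0): e | move/matrixP/(_ 1 1): e]; rewrite !mx2E.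
Qed.

Definition mx2s := (mx2_mul, mx2_add, mx2_opp, mx2_scale, mx2_scalar, det_mx2, tr_mx2).

Lemma cayley_hamilton2 (A : 'M[R]_2) : A *m A = \tr A *: A - (\det A)%:M.
Proof. by case: A / (mx2P A) => x y z w; rewrite !mx2s; congr mx2; ring. Qed.

End TwoByTwo.

Lemma inv_mx2 (K : fieldType) (x y z w : K) : x * w - y * z != 0 ->
  invmx (mx2 x y z w) = (x * w - y * z)^-1 *: mx2 w (- y) (- z) x.
Proof.
move=> d0; have u : mx2 x y z w \in unitmx by rewrite unitmxE det_mx2 unitfE.
apply: (can_inj (mulKmx u)); rewrite mulmxV // -scalemxAr !mx2s.
by congr mx2; field.
Qed.

(** * Eigenframes and splittings of quaternion algebras *)

Section Frame.
Variable K : fieldType.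
Hypothesis n2 : (2%:R : K) != 0.

Lemma mx2_mulv (x y z w : K) (v : 'cV[K]_2) :
  (mx2 x y z w *m v) 0 0 = x * v 0 0 + y * v 1 0 /\
  (mx2 x y z w *m v) 1 0 = z * v 0 0 + w * v 1 0.
Proof.
have e : lift ord0 ord0 = 1 :> 'I_2 by apply/val_inj.
by rewrite !mxE !big_ord_recl !big_ord0 /= !addr0 !e !mx2E.
Qed.

Definition cols (v w : 'cV[K]_2) : 'M[K]_2 := mx2 (v 0 0) (w 0 0) (v 1 0) (w 1 0).

Lemma mul_cols M v w : M *m cols v w = cols (M *m v) (M *m w).
Proof.
case: M / (mx2P M) => x y z u.
have [v0 v1] := mx2_mulv x y z u v; have [w0 w1] := mx2_mulv x y z u w.
by rewrite /cols v0 v1 w0 w1 mx2_mul.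
Qed.

Lemma cols_mul v w x y z u :
  cols v w *m mx2 x y z u = cols (x *: v + z *: w) (y *: v + u *: w).
Proof. by rewrite mx2_mul /cols !mxE; congr mx2; ring. Qed.

(* [v] is an eigenvector of [Y] for [r], so [I v] is one for [-r]; the frame is [(v, t I v)]. *)
Lemma torus_frame (I Y : 'M[K]_2) r : r != 0 ->
  I *m I = - 1%:M -> I *m Y = - (Y *m I) -> Y *m Y = (r ^+ 2)%:M ->
  exists h t, [/\ \det h = 1, t != 0, Y *m h = h *m mx2 r 0 0 (- r) &
    I *m h = h *m mx2 0 (- t) t^-1 0].
Proof.
move=> r0 II IY YY.
have IIv (v : 'cV_2) : I *m (I *m v) = - v by rewrite mulmxA II mulNmx mul1mx.
have I_inj (v : 'cV_2) : I *m v = 0 -> v = 0.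
  by move=> e; move: (IIv v); rewrite e mulmx0 => /eqP; rewrite eq_sym oppr_eq0 => /eqP.
have double0 (v : 'cV[K]_2) : r *: v = - (r *: v) -> v = 0.
  move/eqP; rewrite -addr_eq0 -mulr2n -scaler_nat scalerA scaler_eq0.
  by rewrite mulf_eq0 (negPf n2) (negPf r0) => /eqP.
(* Otherwise [Y = - r] is central, and anticommuting with the invertible [I] is impossible as [2 r]
   is nonzero. *)
have [j [i vi]] : exists j i, (Y + r%:M) i j != 0.
  suff /matrix0Pn[i [j h]] : Y + r%:M != 0 by exists j, i.
  apply/negP; rewrite addr_eq0 => /eqP YE.
  have e0 : I *m delta_mx 0 0 = 0 :> 'cV[K]_2.
    have e : - (r *: I) = r *: I.
      by move: IY; rewrite YE mulmxN mulNmx opprK mul_mx_scalar mul_scalar_mx.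
    by apply: double0; rewrite scalemxAl -{1}e mulNmx.
  have /matrixP/(_ 0 0) := I_inj _ e0; rewrite !mxE !eqxx /= => /eqP.
  by rewrite oner_eq0.
(* Since [(Y - r) (Y + r) = 0], every column of [Y + r] is an eigenvector for [r]. *)
set v := col j (Y + r%:M); have vi0 : v i 0 != 0 by rewrite mxE.
have Yv : Y *m v = r *: v.
  rewrite /v !colE mulmxA mulmxDr YY mul_mx_scalar scalemxAl scalerDr addrC.
  by rewrite scale_scalar_mx expr2.
set w := I *m v.
have Yw : Y *m w = - (r *: w).
  by rewrite /w mulmxA -[Y *m I]opprK -IY mulNmx -mulmxA Yv -scalemxAr.
(* Eigenvectors for the distinct values [r] and [- r] are not proportional. *)
have d0 : \det (cols v w) != 0.
  apply/negP; rewrite det_mx2 subr_eq0 => /eqP d0.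
  have e : w i 0 *: v = v i 0 *: w.
    apply/matrixP => k l; rewrite ord1 [LHS]mxE [RHS]mxE.
    move: i k {vi vi0}; apply: ord2P; apply: ord2P.
    - exact: mulrC.
    - by rewrite d0.
    - by rewrite mulrC d0 mulrC.
    - exact: mulrC.
  have wi0 : w i 0 *: v = 0.
    apply: double0; move: (congr1 (mulmx Y) e); rewrite -!scalemxAr Yv Yw.
    by rewrite scalerN !scalerA ![_ * r]mulrC -!scalerA e.
  have : w = 0.
    move/esym/eqP: e; rewrite wi0 scaler_eq0 (negPf vi0) => /eqP //.
  by move/I_inj => v0; rewrite v0 mxE eqxx in vi0.
set t := (\det (cols v w))^-1.
exists (cols v (t *: w)), t.
have dh : \det (cols v (t *: w)) = 1.
  have -> : cols v (t *: w) = cols v w *m mx2 1 0 0 t.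
    by rewrite cols_mul scale1r !scale0r addr0 add0r.
  by rewrite det_mulmx [X in _ * X]det_mx2 mul1r mulr0 subr0 mulfV.
have t0 : t != 0 by rewrite invr_neq0.
split=> //.
  rewrite mul_cols cols_mul Yv -scalemxAr Yw !scale0r addr0 add0r.
  by rewrite scaleNr !scalerA scalerN scalerA mulrC.
rewrite mul_cols cols_mul -scalemxAr IIv -/w !scale0r add0r addr0 scalerA mulVf // scale1r.
by rewrite scalerN scaleNr.
Qed.

Lemma split_quat (a b x y : K) : a != 0 -> b != 0 -> a * x ^+ 2 + b * y ^+ 2 = 1 ->
  exists phi : quat K -> 'M[K]_2,
  [/\ (forall q q', phi (qadd q q') = phi q + phi q'),
      (forall c q, phi (qscale c q) = c *: phi q),
      (forall q q', phi (qmul a b q q') = phi q *m phi q'),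
      phi (qone K) = 1%:M &
      bijective phi].
Proof.
move=> a0 b0 e1.
(* [x e2 + y e3] squares to [1] and is sent to [diag(1,-1)]; [- b y e2 + a x e3] anticommutes
   with it and squares to [a b]. *)
pose Z (q : quat K) := a * x * q2 q + b * y * q3 q.
pose W (q : quat K) := x * q3 q - y * q2 q.
pose phi q := mx2 (q1 q + Z q) (a * b * (W q + q4 q)) (W q - q4 q) (q1 q - Z q).
exists phi; split.
- by case=> ? ? ? ? [? ? ? ?]; rewrite /phi /Z /W /qadd /= mx2_add; congr mx2; ring.
- by move=> c [? ? ? ?]; rewrite /phi /Z /W /qscale /= mx2_scale; congr mx2; ring.
- case=> q1 q2 q3 q4 [r1 r2 r3 r4]; rewrite /phi /Z /W /qmul /= mx2_mul.
  (* In [E1] and [E2] the right side is the left side times [a x^2 + b y^2], which is 1. *)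
  have E1 : a * q2 * r2 + b * q3 * r3 = (a * x * q2 + b * y * q3) * (a * x * r2 + b * y * r3)
      + a * b * (x * q3 - y * q2) * (x * r3 - y * r2).
    by rewrite -[LHS]mulr1 -e1; ring.
  have E2 : q2 * r3 - q3 * r2 = (a * x * q2 + b * y * q3) * (x * r3 - y * r2)
      - (x * q3 - y * q2) * (a * x * r2 + b * y * r3).
    by rewrite -[LHS]mulr1 -e1; ring.
  have red (s u v w : K) : v = w -> s - u = v - w -> s = u.
    by move=> -> /eqP; rewrite subrr subr_eq0 => /eqP.
  congr mx2.
  + by apply: (red _ _ _ _ E1); ring.
  + by apply: (red _ _ _ _ (congr1 (fun z => a * b * z) E2)); cbv beta; ring.
  + by apply: (red _ _ _ _ (congr1 (fun z => - z) E2)); cbv beta; ring.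
  + by apply: (red _ _ _ _ E1); ring.
- by rewrite /phi /Z /W /qone /= mx2_scalar; congr mx2; ring.
(* The entries of [M] give [Z], [W] and [q4]. The linear map from [(q2, q3)] to [(Z, W)] has
   determinant [a x^2 + b y^2 = 1], whence the division-free formulas in the middle. *)
pose psi (M : 'M[K]_2) :=
  let z := (M 0 0 - M 1 1) / 2%:R in let w := (M 0 1 / (a * b) + M 1 0) / 2%:R in
  Quat ((M 0 0 + M 1 1) / 2%:R) (x * z - b * y * w) (y * z + a * x * w)
       ((M 0 1 / (a * b) - M 1 0) / 2%:R).
exists psi.
  case=> q1 q2 q3 q4; rewrite /psi /phi !mx2E /Z /W /=; congr Quat.
  + by field.
  + by rewrite -[RHS]mul1r -[X in _ = X * _]e1; field; rewrite ?n2 ?a0 ?b0.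
  + by rewrite -[RHS]mul1r -[X in _ = X * _]e1; field; rewrite ?n2 ?a0 ?b0.
  + by field; rewrite ?n2 ?a0 ?b0.
move=> M; case: M / (mx2P M) => m1 m2 m3 m4; rewrite /psi /phi !mx2E /=.
set q := Quat _ _ _ _.
have -> : Z q = (m1 - m4) / 2%:R.
  by rewrite /Z /q /= -[RHS]mul1r -[X in _ = X * _]e1; field; rewrite ?n2 ?a0 ?b0.
have -> : W q = (m2 / (a * b) + m3) / 2%:R.
  by rewrite /W /q /= -[RHS]mul1r -[X in _ = X * _]e1; field; rewrite ?n2 ?a0 ?b0.
by congr mx2; field; rewrite ?n2 ?a0 ?b0.
Qed.

End Frame.

(** * Solving [c x^2 + d y^2 = 1] modulo [p] *)

Lemma card_image_le2 (T U : finType) (f : T -> U) (g : T -> T) :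
  (forall x y, f x = f y -> y = x \/ y = g x) -> (#|T| <= #|f @: setT| * 2)%N.
Proof.
move=> hf; rewrite -cardsT -sum1_card (partition_big_imset f) /= -sum_nat_const.
apply: leq_sum => y /imsetP[x _ ->].
rewrite sum1_card; apply: leq_trans (_ : #|[set x; g x]| <= _)%N; last first.
  by rewrite cards2; case: eqP.
apply/subset_leq_card/subsetP => z; rewrite !inE => /andP[_ /eqP/esym/hf].
by case=> ->; rewrite eqxx ?orbT.
Qed.

(** Pigeonhole: [c x^2] and [1 - d y^2] each take at least [(p + 1) / 2] values, so the two sets of
    values meet. *)
Lemma conic_Fp p (c d : 'F_p) : prime p -> p != 2%N -> c != 0 -> d != 0 ->
  exists x y, c * x ^+ 2 + d * y ^+ 2 = 1.
Proof.
move=> p_pr p2 c0 d0.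
have sq (e x y : 'F_p) : e != 0 -> e * x ^+ 2 = e * y ^+ 2 -> y = x \/ y = - x.
  move=> e0 /(mulfI e0)/esym/eqP; rewrite -subr_eq0 subr_sqr mulf_eq0 subr_eq0 addr_eq0.
  by case/orP => /eqP; auto.
pose f x := c * x ^+ 2; pose g y := 1 - d * y ^+ 2.
have hf : (#|'F_p| <= #|f @: setT| * 2)%N.
  by apply: (card_image_le2 (g := -%R)) => x y /(sq _ _ _ c0).
have hg : (#|'F_p| <= #|g @: setT| * 2)%N.
  apply: (card_image_le2 (g := -%R)) => x y; rewrite /g => /addrI/oppr_inj; exact: sq.
have [dis|] := boolP [disjoint f @: setT & g @: setT]; last first.
  case/pred0Pn => _ /andP[/imsetP[x _ ->] /imsetP[y _]]; rewrite /f /g => e.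
  by exists x, y; rewrite e subrK.
move: dis; rewrite -leq_card_setU => /eqP e; exfalso.
have : (#|f @: setT| + #|g @: setT| <= #|'F_p|)%N by rewrite -e max_card.
have : odd p by case: (even_prime p_pr) p2 => [->|].
move: hf hg; rewrite card_Fp //; move: #|f @: _| #|g @: _| => A B.
by clear; lia.
Qed.

Lemma int_Fp_eq0 p (m : int) : prime p -> (m%:~R == 0 :> 'F_p) = (p %| `|m|)%N.
Proof.
move=> p_pr; rewrite (dvdn_pcharf (pchar_Fp p_pr)).
by case: m => n //; rewrite NegzE rmorphN /= oppr_eq0.
Qed.

Definition punit (p : nat) (q : rat) := ~~ (p %| `|numq q|)%N && ~~ (p %| `|denq q|)%N.

(** A solution modulo [p] is lifted to integers. The defect is kept as an explicit fraction over the
    common denominator of [c] and [d], ready for [hensel_sqrt]. *)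
Lemma conic_rat p (c d : rat) : prime p -> p != 2%N -> punit p c -> punit p d ->
  exists x y m n : int, c * x%:~R ^+ 2 + d * y%:~R ^+ 2 = 1 + m%:~R / n%:~R /\
    (p %| `|m|)%N /\ ~~ (p %| `|n|)%N.
Proof.
move=> p_pr p2 /andP[nc dc] /andP[nd dd].
have F (k : int) : ~~ (p %| `|k|)%N -> k%:~R != 0 :> 'F_p by rewrite int_Fp_eq0.
have [||x [y e]] := @conic_Fp p ((numq c)%:~R / (denq c)%:~R) ((numq d)%:~R / (denq d)%:~R) p_pr p2.
- by rewrite mulf_neq0 ?invr_neq0 ?F.
- by rewrite mulf_neq0 ?invr_neq0 ?F.
pose X : int := (x : nat)%:Z; pose Y : int := (y : nat)%:Z.
have hX : X%:~R = x by rewrite /X; exact: natr_Zp.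
have hY : Y%:~R = y by rewrite /Y; exact: natr_Zp.
exists X, Y, (numq c * denq d * X ^+ 2 + numq d * denq c * Y ^+ 2 - denq c * denq d),
  (denq c * denq d); split; last split.
- rewrite -{1}[c]divq_num_den -{1}[d]divq_num_den !(rmorphD, rmorphN, rmorphM, rmorphXn) /=.
  have : (denq c)%:~R != 0 :> rat by rewrite intr_eq0 denq_neq0.
  have : (denq d)%:~R != 0 :> rat by rewrite intr_eq0 denq_neq0.
  by move=> h1 h2; field; rewrite h1.
- rewrite -int_Fp_eq0 // !(rmorphD, rmorphN, rmorphM, rmorphXn) /= hX hY subr_eq0.
  apply/eqP; rewrite -[RHS]mulr1 -e; field; by rewrite !F.
by rewrite abszM Euclid_dvdM // negb_or dc.
Qed.

(** * The completion [Q_p] *)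

Section Abs.
Variables (p : nat) (K : fieldType) (iota : {rmorphism rat -> K}) (abs : K -> rat).
Hypothesis p_pr : prime p.
Hypothesis HQ : is_Qp p iota abs.

Let P : K := p%:R.

Lemma pr_gt0 : (0 : rat) < p%:R. Proof. by rewrite ltr0n prime_gt0. Qed.
Lemma pr_neq0 : (p%:R : rat) != 0. Proof. by rewrite gt_eqF // pr_gt0. Qed.
Lemma pr_gt1 : (1 : rat) < p%:R. Proof. by rewrite ltr1n prime_gt1. Qed.

Lemma abs_ge0 x : 0 <= abs x. Proof. by case: HQ => [[]]. Qed.
Lemma absM : {morph abs : x y / x * y}. Proof. by case: HQ => [[]]. Qed.
Lemma abs_eq0 x : (abs x == 0) = (x == 0).
Proof.
case: HQ => [[_ h _ _]] _; apply/eqP/eqP => /h //.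
Qed.
Lemma abs0 : abs 0 = 0. Proof. by apply/eqP; rewrite abs_eq0. Qed.
Lemma abs_gt0 x : (0 < abs x) = (x != 0). Proof. by rewrite lt0r abs_ge0 abs_eq0 andbT. Qed.
Lemma abs1 : abs 1 = 1.
Proof.
have n0 : abs 1 != 0 by rewrite abs_eq0 oner_neq0.
by apply: (mulfI n0); rewrite -absM !mulr1.
Qed.
Lemma absV x : abs x^-1 = (abs x)^-1.
Proof.
have [->|x0] := eqVneq x 0; first by rewrite invr0 abs0 invr0.
have n0 : abs x != 0 by rewrite abs_eq0.
by apply: (mulfI n0); rewrite -absM !divff // abs1.
Qed.
Lemma absN x : abs (- x) = abs x.
Proof.
have h : abs (-1) = 1.
  apply/eqP; rewrite -sqrp_eq1 ?abs_ge0 //.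
  by rewrite expr2 -absM mulrNN mulr1 abs1.
by rewrite -mulN1r absM h mul1r.
Qed.
Lemma absX n : {morph abs : x / x ^+ n}.
Proof. by move=> x; elim: n => [|n IH]; rewrite ?expr0 ?abs1 // !exprS absM IH. Qed.
Lemma absXz (k : int) : {morph abs : x / x ^ k}.
Proof. by move=> x; case: k => n; rewrite -?exprnP ?NegzE -?exprnN ?absV absX. Qed.

Lemma absD e x y : abs x <= e -> abs y <= e -> abs (x + y) <= e.
Proof.
move=> hx hy; case: HQ => [[_ _ _ h]] _; apply: le_trans (h x y) _.
by rewrite ge_max hx.
Qed.
Lemma absB e x y : abs x <= e -> abs y <= e -> abs (x - y) <= e.
Proof. by move=> hx hy; apply: absD; rewrite ?absN. Qed.
Lemma absDl x y : abs y < abs x -> abs (x + y) = abs x.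
Proof.
move=> h; apply: le_anti; rewrite absD ?(ltW h) //=.
rewrite leNgt; apply/negP => h2.
have [_ _ _ hm] := HQ.1.
have : abs (x + y - y) <= Num.max (abs (x + y)) (abs y) by rewrite -(absN y) hm.
by rewrite addrK le_max leNgt h2 leNgt h.
Qed.
Lemma abs_mul_le1 x y : abs x <= 1 -> abs y <= 1 -> abs (x * y) <= 1.
Proof. by move=> hx hy; rewrite absM mulr_ile1 ?abs_ge0. Qed.
Lemma abs_mul_le e f x y : abs x <= e -> abs y <= f -> abs (x * y) <= e * f.
Proof. by move=> hx hy; rewrite absM ler_pM ?abs_ge0. Qed.

Lemma abs_iota q : abs (iota q) = padic_abs p q. Proof. by case: HQ => _ []. Qed.
Lemma abs_dense x e : 0 < e -> exists q, abs (x - iota q) < e.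
Proof. by case: HQ => _ [_ h _]; apply: h. Qed.

Lemma abs_iota_int (n : int) :
  abs n%:~R = if n == 0 then 0 else p%:R ^ (- (logn p `|n|)%:Z).
Proof.
rewrite -(rmorph_int iota) abs_iota /padic_abs intr_eq0; case: eqP => // _.
by rewrite denq_int numq_int logn1 sub0r.
Qed.

Lemma abs_int_le1 (n : int) : abs n%:~R <= 1.
Proof.
rewrite abs_iota_int; case: eqP => // _.
by rewrite -exprnN invf_le1 ?exprn_ege1 ?exprn_gt0 ?pr_gt0 ?(ltW pr_gt1).
Qed.

Lemma abs_nat_le1 (n : nat) : abs n%:R <= 1.
Proof. exact: (abs_int_le1 n). Qed.

Lemma abs_P : abs P = p%:R^-1.
Proof.
rewrite -[P]/((p : int)%:~R) abs_iota_int eqz_nat eqn0Ngt prime_gt0 //=.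
by rewrite logn_prime // eqxx.
Qed.
Lemma P_neq0 : P != 0.
Proof. by rewrite -abs_eq0 abs_P invr_eq0 pr_neq0. Qed.
Lemma abs_PX (k : int) : abs (P ^ k) = p%:R ^ (- k).
Proof. by rewrite absXz abs_P exprz_inv. Qed.
Lemma PX_neq0 (k : int) : P ^ k != 0. Proof. by rewrite expfz_neq0 ?P_neq0. Qed.

Lemma abs_int_dvd (n : int) : (p %| `|n|)%N -> abs n%:~R <= p%:R^-1.
Proof.
move=> h; have /dvdzP[k ->] : (p%:Z %| n)%Z by rewrite dvdzE.
rewrite intrM absM -[p%:Z%:~R]/P abs_P.
by rewrite ler_piMl ?abs_int_le1 // invr_ge0 ltW ?pr_gt0.
Qed.

Lemma abs_int_unit (n : int) : ~~ (p %| `|n|)%N -> abs n%:~R = 1.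
Proof.
move=> h; rewrite abs_iota_int ifF; last by apply/eqP => n0; rewrite n0 dvdn0 in h.
by rewrite lognE (negPf h) !andbF oppr0 expr0z.
Qed.

(** A rational closer to [x] than [abs x] has the same absolute value, so the completion takes no
    new values. *)
Lemma abs_val x : x != 0 -> exists k : int, abs x = p%:R ^ k.
Proof.
rewrite -abs_gt0 => x0; have [q hq] := abs_dense x x0.
have e : abs x = abs (iota q).
  have h : abs (iota q - x) < abs x by rewrite -absN opprB.
  by rewrite -(absDl h) addrC subrK.
move: x0; rewrite e abs_iota /padic_abs; case: eqP => // _ _; eexists; reflexivity.
Qed.

Lemma ltr_prz (m n : int) : ((p%:R : rat) ^ m < p%:R ^ n) = (m < n).
Proof. by rewrite ltr_eXz2l ?pr_gt1. Qed.
Lemma ler_prz (m n : int) : ((p%:R : rat) ^ m <= p%:R ^ n) = (m <= n).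
Proof. by rewrite ler_eXz2l ?pr_gt1. Qed.
Lemma eq_prz (m n : int) : (p%:R : rat) ^ m = p%:R ^ n -> m = n.
Proof. by move=> h; apply/le_anti; rewrite -!ler_prz h lexx. Qed.

Lemma abs_lt1 x : abs x < 1 -> abs x <= p%:R^-1.
Proof.
have [->|/abs_val[k ->]] := eqVneq x 0; first by rewrite abs0 invr_ge0 ltW ?pr_gt0.
rewrite -(expr0z (p%:R : rat)) ltr_prz -exprN1 ler_prz; lia.
Qed.

Lemma absPV x : abs (x / P) <= 1 = (abs x <= p%:R^-1).
Proof. by rewrite absM absV abs_P invrK -ler_pdivlMr ?pr_gt0 // mul1r. Qed.

Lemma small_eq0 x : (forall n : nat, abs x <= p%:R ^- n) -> x = 0.
Proof.
move=> h; apply/eqP; rewrite -abs_eq0; apply/negPn/negP; rewrite abs_eq0.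
move=> x0; have [k hk] := abs_val x0.
have := h (`|k| + 1)%N; rewrite hk exprnN ler_prz; lia.
Qed.

Lemma small_pow (e : rat) : 0 < e -> exists n : nat, p%:R ^- n < e.
Proof.
move=> e0; exists (Num.truncn e^-1).+1.
rewrite invf_plt ?posrE ?exprn_gt0 ?pr_gt0 //.
have h1 : e^-1 < (Num.truncn e^-1).+1%:R.
  by rewrite truncnS_gt // realE invr_ge0 ltW.
apply: lt_trans h1 _; rewrite -natrX ltr_nat; apply: ltn_expl; exact: prime_gt1.
Qed.

Lemma abs_two : p != 2%N -> abs 2%:R = 1.
Proof.
move=> p2; apply: (abs_int_unit (n := 2)); apply: contra p2 => h.
by rewrite -(dvdn_prime2 p_pr).
Qed.

Lemma hensel_sqrt eps : p != 2%N -> abs eps <= p%:R^-1 ->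
  exists2 r, r ^+ 2 = 1 + eps & abs r = 1.
Proof.
move=> p2 he; have a2 := abs_two p2; set q : rat := p%:R^-1.
have two0 : (2%:R : K) != 0 by rewrite -abs_eq0 a2 oner_neq0.
have q0 : 0 < q by rewrite invr_gt0 pr_gt0.
have q1 : q < 1 by rewrite invf_lt1 ?pr_gt0 ?pr_gt1.
have half z : abs (z / 2%:R) = abs z by rewrite absM absV a2 invr1 mulr1.
(* If [l] is the fixed point of this contraction, [1 + l] is the square root. *)
pose y n := iter n (fun z => (eps - z ^+ 2) / 2%:R) 0.
have yS n : y n.+1 = (eps - y n ^+ 2) / 2%:R by [].
have yq n : abs (y n) <= q.
  elim: n => [|n IH]; first by rewrite abs0 ltW.
  rewrite yS half; apply: absB => //; rewrite expr2 -[q]mulr1.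
  by apply: abs_mul_le => //; apply: le_trans IH (ltW q1).
(* A difference of squares factors, and the sum of two iterates contributes the extra factor [q]. *)
have ydiff n : abs (y n.+1 - y n) <= q ^+ n.+1.
  elim: n => [|n IH]; first by rewrite yS subr0 half expr0n subr0 expr1.
  rewrite yS [X in _ - X]yS (_ : _ - _ = (y n - y n.+1) * (y n + y n.+1) / 2%:R); last by field.
  rewrite half exprSr; apply: abs_mul_le; last exact: absD.
  by rewrite -absN opprB.
have qX m n : (m <= n)%N -> q ^+ n <= q ^+ m.
  by move=> mn; rewrite ler_wiXn2l ?ltW.
have ycauchy m n : abs (y (n + m)%N - y n) <= q ^+ n.
  elim: m => [|m IH]; first by rewrite addn0 subrr abs0 exprn_ge0 // ltW.
  rewrite addnS (_ : _ - _ = (y (n + m).+1 - y (n + m)%N) + (y (n + m)%N - y n)); last by ring.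
  by apply: absD => //; apply: le_trans (ydiff _) _; apply: qX; rewrite -addnS leq_addr.
have small e : 0 < e -> exists N, q ^+ N < e.
  by move=> /small_pow[N hN]; exists N; rewrite exprVn.
case: HQ => _ [_ _ /(_ y)[e /small[N hN]|l hl]].
  exists N; have key m : (N <= m)%N -> abs (y m - y N) <= q ^+ N.
    by move=> h; have := ycauchy (m - N)%N N; rewrite subnKC.
  move=> m n /key hm /key hn; apply: le_lt_trans hN.
  by rewrite (_ : _ - _ = (y m - y N) - (y n - y N)); [apply: absB|ring].
have e0 : l ^+ 2 + 2%:R * l - eps = 0.
  apply: small_eq0 => k; rewrite -exprVn -/q.
  have [N hN] := hl _ (exprn_gt0 k q0).
  (* [N] makes [y n] close to [l], and [k] makes the step from [y n] to [y n.+1] small. *)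
  set n := maxn N k; have {hN} hn := ltW (hN n (leq_maxl _ _)).
  have l1 : abs l <= 1.
    rewrite (_ : l = y n - (y n - l)); last by ring.
    apply: absB; first exact: le_trans (yq n) (ltW q1).
    by apply: le_trans hn _; rewrite exprn_ile1 // ltW.
  have yn1 : abs (y n) <= 1 by apply: le_trans (yq n) (ltW q1).
  rewrite (_ : _ - _ = - (y n - l) * (l + y n + 2%:R) - 2%:R * (y n.+1 - y n)); last first.
    by rewrite yS; field.
  apply: absB.
    rewrite -[X in _ <= X]mulr1; apply: abs_mul_le; rewrite ?absN //.
    by apply: absD; [apply: absD|rewrite a2].
  rewrite absM a2 mul1r; apply: le_trans (ydiff n) _; apply: qX.
  by rewrite ltnW // ltnS leq_maxr.
exists (1 + l); first by rewrite -[LHS]subr0 -e0; ring.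
have : abs ((1 + l) ^+ 2) = 1.
  have -> : (1 + l) ^+ 2 = 1 + eps by rewrite -[LHS]subr0 -e0; ring.
  by rewrite absDl abs1 //; apply: le_lt_trans he _.
rewrite absX => /eqP; rewrite sqrp_eq1 ?abs_ge0 //; exact/eqP.
Qed.

(** The defect goes into the square root [r], so [x] and [y] stay rational and can serve as
    coefficients of a rational quaternion. *)
Lemma conic_Qp c d : p != 2%N -> punit p c -> punit p d ->
  exists x y r, iota (c * x ^+ 2 + d * y ^+ 2) = r ^+ 2 /\ abs r = 1.
Proof.
move=> p2 hc hd; have [x [y [m [n [e [hm hn]]]]]] := conic_rat p_pr p2 hc hd.
have [|r r2 r1] := @hensel_sqrt (m%:~R / n%:~R) p2.
  by rewrite absM absV (abs_int_unit hn) invr1 mulr1 abs_int_dvd.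
exists x%:~R, y%:~R, r; split=> //.
by rewrite r2 e rmorphD rmorphM rmorph1 fmorphV !rmorph_int.
Qed.

(** * Lattices as matrices modulo [GL_2(O)] and scalars *)

Definition mle (e : rat) (A : 'M[K]_2) := forall i j, abs (A i j) <= e.
Definition GLO (u : 'M[K]_2) := mle 1 u /\ abs (\det u) = 1.
Definition heq (h h' : 'M[K]_2) :=
  exists c u, [/\ c != 0, GLO u & h' = c *: (h *m u)].

Lemma mle_mx2 e x y z w :
  mle e (mx2 x y z w) <-> [/\ abs x <= e, abs y <= e, abs z <= e & abs w <= e].
Proof.
split=> [h|[hx hy hz hw]].
  by split; [move: (h 0 0)|move: (h 0 1)|move: (h 1 0)|move: (h 1 1)]; rewrite mx2E.
by apply: ord2P; apply: ord2P; rewrite mx2E.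
Qed.

Lemma mle_mul e f A B : mle e A -> mle f B -> mle (e * f) (A *m B).
Proof.
case: A / (mx2P A) => x y z w; case: B / (mx2P B) => x' y' z' w'.
move=> /mle_mx2[h1 h2 h3 h4] /mle_mx2[h5 h6 h7 h8]; rewrite mx2_mul.
by apply/mle_mx2; split; apply: absD; apply: abs_mul_le.
Qed.

Lemma mle_add e A B : mle e A -> mle e B -> mle e (A + B).
Proof. by move=> hA hB i j; rewrite mxE absD. Qed.

Lemma mle_trans e f A : e <= f -> mle e A -> mle f A.
Proof. by move=> ef hA i j; apply: le_trans (hA i j) ef. Qed.

Lemma mle_bound A : exists2 M : rat, 1 <= M & mle M A.
Proof.
case: A / (mx2P A) => x y z w.
exists (1 + abs x + abs y + abs z + abs w).
  by rewrite -!addrA lerDl !addr_ge0 ?abs_ge0.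
have := (abs_ge0 x, abs_ge0 y, abs_ge0 z, abs_ge0 w) => -[[[hx hy] hz] hw].
by apply/mle_mx2; split; lra.
Qed.

Lemma mle1_1 : mle 1 1%:M.
Proof. by rewrite mx2_scalar; apply/mle_mx2; rewrite abs1 abs0; split. Qed.

Lemma mle1_det A : mle 1 A -> abs (\det A) <= 1.
Proof.
case: A / (mx2P A) => x y z w /mle_mx2[h1 h2 h3 h4]; rewrite det_mx2.
by apply: absB; apply: abs_mul_le1.
Qed.

Lemma GLO_1 : GLO 1%:M.
Proof. by split; [exact: mle1_1|rewrite det1 abs1]. Qed.

Lemma GLO_mul u v : GLO u -> GLO v -> GLO (u *m v).
Proof.
move=> [hu du] [hv dv]; split; last by rewrite det_mulmx absM du dv mulr1.
by rewrite -[1]mulr1; apply: mle_mul.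
Qed.

Lemma GLO_unit u : GLO u -> u \in unitmx.
Proof. by case=> _ du; rewrite unitmxE unitfE -abs_eq0 du oner_neq0. Qed.

Lemma GLO_inv u : GLO u -> GLO (invmx u).
Proof.
move=> [hu du]; have d0 : \det u != 0 by rewrite -abs_eq0 du oner_neq0.
split; last by rewrite det_inv absV du invr1.
case: u / (mx2P u) hu du d0 => x y z w /mle_mx2[h1 h2 h3 h4].
rewrite det_mx2 => du d0; rewrite inv_mx2 // mx2_scale; apply/mle_mx2.
by split; rewrite absM absV du invr1 mul1r ?absN.
Qed.

Lemma heq_refl h : heq h h.
Proof.
by exists 1, 1%:M; split; [exact: oner_neq0|exact: GLO_1|rewrite mulmx1 scale1r].
Qed.

Lemma heq_sym h h' : heq h h' -> heq h' h.
Proof.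
move=> [c [u [c0 hu ->]]]; exists c^-1, (invmx u).
split; [by rewrite invr_neq0|exact: GLO_inv|].
by rewrite -scalemxAl scalerA mulVf // scale1r mulmxK // GLO_unit.
Qed.

Lemma heq_trans h h' h'' : heq h h' -> heq h' h'' -> heq h h''.
Proof.
move=> [c [u [c0 hu ->]]] [d [v [d0 hv ->]]]; exists (d * c), (u *m v).
split; [by rewrite mulf_neq0|exact: GLO_mul|].
by rewrite -scalemxAl scalerA mulmxA.
Qed.

Lemma heq_mul g h h' : heq h h' -> heq (g *m h) (g *m h').
Proof.
move=> [c [u [c0 hu ->]]]; exists c, u; split=> //.
by rewrite -scalemxAr mulmxA.
Qed.

Lemma heq_scale c h : c != 0 -> heq h (c *: h).
Proof. by move=> c0; exists c, 1%:M; split; [|exact: GLO_1|rewrite mulmx1]. Qed.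

Lemma heq_GLO h u : GLO u -> heq h (h *m u).
Proof. by move=> hu; exists 1, u; split; rewrite ?oner_neq0 ?scale1r. Qed.

Lemma lattice_sub h h' : h' \in unitmx ->
  lsub (lattice_of abs h) (lattice_of abs h') <-> mle 1 (invmx h' *m h).
Proof.
move=> h0; split=> [hs i j|hm w [u [hu ->]]].
  have [|u [hu e]] := hs (h *m delta_mx j 0).
    exists (delta_mx j 0); split=> // k; rewrite mxE eqxx andbT.
    by case: eqP => _; rewrite ?abs1 ?abs0.
  have -> : (invmx h' *m h) i j = u i 0.
    move: e => /(congr1 (mulmx (invmx h'))); rewrite mulKmx // => <-.
    by rewrite mulmxA -colE [RHS]mxE.
  exact: hu.
exists (invmx h' *m h *m u); split; last by rewrite !mulmxA mulmxV // mul1mx.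
move=> i; rewrite mxE !big_ord_recl big_ord0 addr0.
by apply: absD; apply: abs_mul_le1.
Qed.

Lemma lscale_lattice c h w :
  lscale c (lattice_of abs h) w <-> lattice_of abs (c *: h) w.
Proof.
split=> [[w0 [[u [hu ->]] ->]]|[u [hu ->]]].
  by exists u; rewrite -scalemxAl.
by exists (h *m u); rewrite -scalemxAl; split=> //; exists u.
Qed.

Lemma homothetic_refl (L : vsetT K) : homothetic L L.
Proof.
exists 1; split; first exact: oner_neq0.
move=> w; split=> [Lw|[w0 [Lw ->]]]; last by rewrite scale1r.
by exists w; rewrite scale1r.
Qed.

Lemma homothetic_sym (L M : vsetT K) : homothetic L M -> homothetic M L.
Proof.
move=> [c [c0 h]]; exists c^-1; split; first by rewrite invr_neq0.
move=> w; split=> [Lw|[w0 [/h[w1 [Lw ->]] ->]]]; last first.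
  by rewrite scalerA mulVf // scale1r.
exists (c *: w); rewrite scalerA mulVf // scale1r; split=> //.
by apply/h; exists w.
Qed.

Lemma homothetic_trans (L M N : vsetT K) :
  homothetic L M -> homothetic M N -> homothetic L N.
Proof.
move=> [c [c0 h]] [d [d0 h']]; exists (d * c); split; first by rewrite mulf_neq0.
move=> w; rewrite h'; split=> [[w0 [/h[w1 [Lw ->]] ->]]|[w0 [Lw ->]]].
  by exists w1; rewrite scalerA.
by exists (c *: w0); rewrite scalerA; split=> //; apply/h; exists w0.
Qed.

(** Lattices are predicates, so equality of sets is only pointwise equivalence; homothety replaces
    equality throughout. *)
Lemma eqv_homothetic (L M : vsetT K) : (forall w, M w <-> L w) -> homothetic L M.
Proof.
move=> h; have [c [c0 hc]] := homothetic_refl L.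
by exists c; split=> // w; rewrite h hc.
Qed.

Lemma heq_homothetic h h' :
  heq h h' -> homothetic (lattice_of abs h) (lattice_of abs h').
Proof.
move=> [c [u [c0 hu ->]]]; exists c; split=> // w; rewrite lscale_lattice.
have u0 := GLO_unit hu.
rewrite scalemxAl; set g := c *: h; split=> [[v [hv ->]]|[v [hv ->]]].
  exists (u *m v); rewrite mulmxA; split=> // i.
  rewrite mxE !big_ord_recl big_ord0 addr0.
  by apply: absD; apply: abs_mul_le1; rewrite ?hu.1.
exists (invmx u *m v); rewrite mulmxA mulmxK //; split=> // i.
rewrite mxE !big_ord_recl big_ord0 addr0.
by apply: absD; apply: abs_mul_le1; rewrite ?(GLO_inv hu).1.
Qed.

(** The two transition matrices are integral and mutually inverse, so their determinants are
    units. *)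
Lemma lattice_eq h h' : h \in unitmx -> h' \in unitmx ->
  lsub (lattice_of abs h) (lattice_of abs h') ->
  lsub (lattice_of abs h') (lattice_of abs h) ->
  exists2 u, GLO u & h' = h *m u.
Proof.
move=> h0 h0' /lattice_sub s1 /lattice_sub s2.
exists (invmx h *m h'); last by rewrite mulmxA mulmxV // mul1mx.
have {}s1 := s1 h0'; have {}s2 := s2 h0; split=> //.
have d1 := mle1_det s1; have d2 := mle1_det s2.
apply: le_anti; rewrite d2 /=.
have e : abs (\det (invmx h *m h')) * abs (\det (invmx h' *m h)) = 1.
  rewrite -absM -det_mulmx -mulmxA [h' *m _]mulmxA mulmxV // mul1mx mulVmx //.
  by rewrite det1 abs1.
have := abs_ge0 (\det (invmx h *m h')).
by move=> h1; rewrite -e ler_piMr.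
Qed.

Lemma homotheticP h h' : h \in unitmx -> h' \in unitmx ->
  homothetic (lattice_of abs h) (lattice_of abs h') <-> heq h h'.
Proof.
move=> h0 h0'; split; last exact: heq_homothetic.
move=> [c [c0 e]].
have ch0 : c *: h \in unitmx by rewrite unitmxZ // unitfE.
have [||u hu ->] := lattice_eq ch0 h0'.
- by move=> w hw; apply/e/lscale_lattice.
- by move=> w /e/lscale_lattice.
by exists c, u; rewrite scalemxAl.
Qed.

(** Convertible with [actL] when [g] is the matrix of a quaternion; arbitrary [g] allows inverses
    and products of matrices. *)
Definition mact (g : 'M[K]_2) (L : vsetT K) : vsetT K :=
  fun w => exists w0, L w0 /\ w = g *m w0.

Lemma mact_lattice g h :
  homothetic (lattice_of abs (g *m h)) (mact g (lattice_of abs h)).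
Proof.
apply: eqv_homothetic => w; split=> [[w0 [[u [hu ->]] ->]]|[u [hu ->]]].
  by exists u; rewrite mulmxA.
by exists (h *m u); rewrite mulmxA; split=> //; exists u.
Qed.

Lemma mact_hom g L M : homothetic L M -> homothetic (mact g L) (mact g M).
Proof.
move=> [c [c0 h]]; exists c; split=> // w; split.
  move=> [w0 [/h[w1 [Lw ->]] ->]]; exists (g *m w1).
  by rewrite scalemxAr; split=> //; exists w1.
move=> [w0 [[w1 [Lw ->]] ->]]; exists (c *: w1); rewrite scalemxAr; split=> //.
by apply/h; exists w1.
Qed.

Lemma mact_comp g h L : homothetic (mact (g *m h) L) (mact g (mact h L)).
Proof.
apply: eqv_homothetic => w; split=> [[w0 [[w1 [Lw ->]] ->]]|[w1 [Lw ->]]].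
  by exists w1; rewrite mulmxA.
by exists (h *m w1); rewrite mulmxA; split=> //; exists w1.
Qed.

Lemma mact1 L : homothetic (mact 1%:M L) L.
Proof.
apply: eqv_homothetic => w; split=> [Lw|[w0 [Lw ->]]]; last by rewrite mul1mx.
by exists w; rewrite mul1mx.
Qed.

Lemma mact_inv g L M : g \in unitmx -> homothetic (mact g L) M ->
  homothetic L (mact (invmx g) M).
Proof.
move=> g0 /(mact_hom (invmx g)); apply: homothetic_trans.
have := mact_comp (invmx g) g L; rewrite mulVmx // => h.
exact: homothetic_trans (homothetic_sym (mact1 L)) h.
Qed.

Lemma mact_inj g L M : g \in unitmx ->
  homothetic (mact g L) (mact g M) -> homothetic L M.
Proof.
move=> g0 /(mact_inv g0) h; apply: homothetic_trans h _.
apply: homothetic_sym; apply: (mact_inv g0); exact: homothetic_refl.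
Qed.

Definition rep (h : 'M[K]_2) (L : vsetT K) := homothetic (lattice_of abs h) L.

Lemma rep_mact g h L : rep h L -> rep (g *m h) (mact g L).
Proof. by move=> hL; apply: homothetic_trans (mact_lattice g h) (mact_hom g hL). Qed.

Lemma rep_heq h h' L : heq h h' -> rep h L -> rep h' L.
Proof. move=> e; apply: homothetic_trans; exact/heq_homothetic/heq_sym. Qed.

Lemma rep_hom h L M : homothetic L M -> rep h L -> rep h M.
Proof. by move=> e r; apply: homothetic_trans r e. Qed.

Lemma rep_inj h L M : rep h L -> rep h M -> homothetic L M.
Proof. by move=> h1 h2; apply: homothetic_trans (homothetic_sym h1) h2. Qed.

Lemma repP h h' L M : h \in unitmx -> h' \in unitmx -> rep h L -> rep h' M ->
  homothetic L M <-> heq h h'.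
Proof.
move=> h0 h0' r r'; split=> [e|e].
  apply/homotheticP => //.
  exact: homothetic_trans r (homothetic_trans e (homothetic_sym r')).
exact: rep_inj (rep_heq e r) r'.
Qed.

Lemma is_lattice_rep L : is_lattice abs L -> exists2 h, h \in unitmx & rep h L.
Proof. by move=> [g [g0 e]]; exists g => //; apply: eqv_homothetic. Qed.

Lemma rep_is_lattice h L : h \in unitmx -> rep h L -> is_lattice abs L.
Proof.
move=> h0 [c [c0 e]]; exists (c *: h); split; first by rewrite unitmxZ // unitfE.
by move=> w; rewrite e lscale_lattice.
Qed.

(** * Adjacency and paths *)

Lemma is_lattice_hom L M : homothetic L M -> is_lattice abs L -> is_lattice abs M.
Proof.
move=> e /is_lattice_rep[h h0 r]; apply: (rep_is_lattice h0); exact: rep_hom e r.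
Qed.

Lemma adjv_hom L L' M M' : homothetic L M -> homothetic L' M' ->
  adjv p abs L L' -> adjv p abs M M'.
Proof.
move=> e e' [l l' n [L1 [L1' [h1 h2 s1 s2]]]]; split.
- exact: is_lattice_hom e l.
- exact: is_lattice_hom e' l'.
- move=> h; apply: n; apply: homothetic_trans e _; apply: homothetic_trans h _.
  exact: homothetic_sym.
exists L1, L1'; split=> //.
  exact: homothetic_trans (homothetic_sym e) h1.
exact: homothetic_trans (homothetic_sym e') h2.
Qed.

(** From [L1] containing [L1'] containing [P L1], one gets [L1'] containing [P L1] containing
    [P L1']. *)
Lemma adjv_sym L L' : adjv p abs L L' -> adjv p abs L' L.
Proof.
move=> [l l' n [L1 [L1' [h1 h2 s1 s2]]]]; split=> //.
  by move=> h; apply: n; apply: homothetic_sym.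
exists L1', (lscale P L1); split=> //.
  apply: homothetic_trans h1 _; exists P; split=> //; exact: P_neq0.
by move=> w [w0 [/s1 Lw ->]]; exists w0.
Qed.

Lemma mact_is_lattice g L : g \in unitmx -> is_lattice abs L -> is_lattice abs (mact g L).
Proof.
move=> g0 /is_lattice_rep[h h0 r]; apply: (@rep_is_lattice (g *m h)).
  by rewrite unitmx_mul g0.
exact: rep_mact.
Qed.

Lemma adjv_mact g L L' : g \in unitmx ->
  adjv p abs L L' -> adjv p abs (mact g L) (mact g L').
Proof.
move=> g0 [l l' n [L1 [L1' [h1 h2 s1 s2]]]]; split; try exact: mact_is_lattice.
  by move=> h; apply: n; apply: mact_inj h.
exists (mact g L1), (mact g L1'); split; try exact: mact_hom.
  by move=> w [w0 [/s1 Lw ->]]; exists w0.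
move=> w [w0 [[w1 [Lw ->]] ->]]; exists (P *: w1); rewrite scalemxAr; split=> //.
by apply: s2; exists w1.
Qed.

(** Column reduction over the integers of [K]: a unit in the top row clears the other entry of that
    row; without one, the top row is divisible by [P]. Taking [t] modulo [P] gives the [p + 1]
    neighbours of a vertex. *)
Lemma hermite m : mle 1 m -> abs (\det m) = p%:R^-1 ->
  (exists2 t, abs t <= 1 & heq (mx2 1 0 t P) m) \/ heq (mx2 P 0 0 1) m.
Proof.
case: m / (mx2P m) => x y z w /mle_mx2[hx hy hz hw]; rewrite det_mx2 => hd.
have P0 := P_neq0.
have dP D : abs D = p%:R^-1 -> abs (D / P) = 1.
  by move=> hD; rewrite absM absV abs_P hD divff // invr_eq0 pr_neq0.
have unit1 v : abs v <= 1 -> ~~ (abs v <= p%:R^-1) -> abs v = 1.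
  move=> h1 h2; apply/le_anti; rewrite h1 leNgt; apply/negP => /abs_lt1 h.
  by rewrite h in h2.
have neq0 v : abs v = 1 -> v != 0 by move=> h; rewrite -abs_eq0 h oner_neq0.
have [sx|/(unit1 _ hx) ux] := boolP (abs x <= p%:R^-1); last first.
  have x0 := neq0 _ ux.
  left; exists (z / x); first by rewrite absM absV ux divr1.
  exists 1, (mx2 x y 0 ((w - z / x * y) / P)); split; first exact: oner_neq0.
  - have e : abs ((w - z / x * y) / P) = 1.
      apply: dP; rewrite -hd (_ : x * w - y * z = x * (w - z / x * y)); last by field.
      by rewrite absM ux mul1r.
    split; first by apply/mle_mx2; rewrite abs0 e; split.
    by rewrite det_mx2 mulr0 subr0 absM ux e mulr1.
  by rewrite scale1r mx2_mul; congr mx2; field; rewrite ?x0 ?P0.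
have [sy|/(unit1 _ hy) uy] := boolP (abs y <= p%:R^-1); last first.
  have y0 := neq0 _ uy.
  left; exists (w / y); first by rewrite absM absV uy divr1.
  exists 1, (mx2 x y ((z - w / y * x) / P) 0); split; first exact: oner_neq0.
  - have e : abs ((z - w / y * x) / P) = 1.
      apply: dP; rewrite -hd (_ : x * w - y * z = - (y * (z - w / y * x))); last by field.
      by rewrite absN absM uy mul1r.
    split; first by apply/mle_mx2; rewrite abs0 e; split.
    by rewrite det_mx2 mulr0 sub0r absN absM uy e mulr1.
  by rewrite scale1r mx2_mul; congr mx2; field; rewrite ?y0 ?P0.
right; exists 1, (mx2 (x / P) (y / P) z w); split; first exact: oner_neq0.
- split; first by apply/mle_mx2; rewrite !absPV; split.
  rewrite det_mx2 (_ : _ - _ = (x * w - y * z) / P); last by field.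
  exact: dP.
by rewrite scale1r mx2_mul; congr mx2; field.
Qed.

(** Both [m] and [P m^-1] are integral, so [det m] has valuation 0, 1 or 2. The extreme values make
    one of them unimodular and the two classes equal; valuation 1 is the case of [hermite]. *)
Lemma neighbour h L L' : h \in unitmx -> rep h L -> adjv p abs L L' ->
  (exists2 t, abs t <= 1 & rep (h *m mx2 1 0 t P) L') \/ rep (h *m mx2 P 0 0 1) L'.
Proof.
move=> h0 r [l /is_lattice_rep[g0 g0u r'] n [L1 [L1' [e1 e2 s1 s2]]]].
have [c [c0 hc]] := homothetic_trans r e1.
have [d [d0 hd]] := homothetic_trans r' e2.
set h1 := c *: h; set g := d *: g0.
have h1u : h1 \in unitmx by rewrite unitmxZ // unitfE.
have gu : g \in unitmx by rewrite unitmxZ // unitfE.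
set m := invmx h1 *m g.
have mu : m \in unitmx by rewrite unitmx_mul unitmx_inv h1u.
have gE : g = h1 *m m by rewrite mulmxA mulmxV // mul1mx.
have hm : mle 1 m.
  apply/(lattice_sub _ h1u) => w hw; apply/lscale_lattice/hc/s1/hd.
  exact/lscale_lattice.
have Ph1 : P *: h1 = g *m (P *: invmx m).
  by rewrite -scalemxAr gE mulmxK.
have P0 := P_neq0.
have Phu : P *: h1 \in unitmx by rewrite unitmxZ // unitfE.
have hm' : mle 1 (P *: invmx m).
  have -> : P *: invmx m = invmx g *m (P *: h1) by rewrite Ph1 mulKmx.
  apply/(lattice_sub _ gu) => w /lscale_lattice[w0 [hw0 ->]].
  apply/lscale_lattice/hd/s2; exists w0; split=> //.
  exact/hc/lscale_lattice.
have hg : heq h1 g -> False.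
  move=> e; apply: n; apply/(repP h0 g0u r r').
  apply: heq_trans (heq_scale _ c0) (heq_trans e _); exact/heq_sym/heq_scale.
have nf : (exists2 t, abs t <= 1 & heq (mx2 1 0 t P) m) \/ heq (mx2 P 0 0 1) m.
  apply: hermite => //.
  have d1 : \det m != 0 by rewrite -unitfE -unitmxE.
  have [k hk] := abs_val d1.
  have := mle1_det hm; have := mle1_det hm'.
  have dPm : abs (\det (P *: invmx m)) = p%:R ^ (- 2 - k).
    rewrite detZ det_inv absM absX absV abs_P hk invr_expz exprnP exprz_inv.
    by rewrite -expfzDr ?pr_neq0.
  rewrite dPm hk -(expr0z (p%:R : rat)) !ler_prz => k2 k0.
  have [k00|kn0] := eqVneq k 0.
    case: hg; rewrite gE; apply: heq_GLO; split=> //.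
    by rewrite hk k00 expr0z.
  have [km2|kn2] := eqVneq k (- 2).
    case: hg; apply: heq_trans (heq_scale _ P0) _; rewrite Ph1.
    apply/heq_sym/heq_GLO; split=> //.
    by rewrite dPm km2 expr0z.
  by have -> : k = -1 by move: k0 k2 kn0 kn2; clear; lia.
have fin n' : heq n' m -> rep (h *m n') L'.
  move=> e; apply: rep_heq r'.
  apply: heq_trans (heq_scale _ d0) _; rewrite -/g gE.
  rewrite -scalemxAl; apply: heq_trans (heq_sym (heq_scale _ c0)) _.
  exact/heq_mul/heq_sym.
by case: nf => [[t t1 /fin]|/fin]; [left; exists t|right].
Qed.

(** * The standard apartment and the types of vertices *)

Definition E (k : int) : 'M[K]_2 := mx2 1 0 0 (P ^ k).

Lemma det_E k : \det (E k) = P ^ k.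
Proof. by rewrite det_mx2 mul1r mulr0 subr0. Qed.

Lemma E_unit k : E k \in unitmx.
Proof. by rewrite unitmxE det_E unitfE PX_neq0. Qed.

Lemma E_add k l : E (k + l) = E k *m E l.
Proof.
by rewrite /E mx2_mul expfzDr ?P_neq0 //; congr mx2; ring.
Qed.

Lemma E0 : E 0 = 1%:M. Proof. by rewrite /E expr0z mx2_scalar. Qed.

(** If [E m = c u] with [u] unimodular, then [u] is diagonal with unit entries, so [c] is a unit and
    then so is [P ^ m]. *)
Lemma heq_E k l : heq (E k) (E l) -> k = l.
Proof.
suff h m : heq 1%:M (E m) -> m = 0.
  move=> e; have := heq_mul (E (- k)) e; rewrite -!E_add addNr E0 => /h; lia.
move=> [c [u [c0 [/[dup] hu + du] e]]].
case: u / (mx2P u) hu du e => x y z w _; rewrite det_mx2 => du.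
rewrite mul1mx mx2_scale => /mx2_inj[ex ey ez ew] /mle_mx2[h1 h2 h3 h4].
have y0 : y = 0 by move/esym/eqP: ey; rewrite mulf_eq0 (negPf c0) => /eqP.
move: du; rewrite y0 mul0r subr0 absM => du.
have [x1 w1] : abs x = 1 /\ abs w = 1.
  have := (abs_ge0 x, abs_ge0 w) => -[hx hw]; split; nra.
have c1 : abs c = 1 by move/(congr1 abs): ex; rewrite abs1 absM x1 mulr1.
move/(congr1 abs): ew; rewrite abs_PX absM c1 w1 mulr1 -(expr0z (p%:R : rat)).
move/eq_prz; lia.
Qed.

Lemma adj_lattice h : h \in unitmx ->
  adjv p abs (lattice_of abs h) (lattice_of abs (h *m E 1)).
Proof.
move=> h0; have e0 : h *m E 1 \in unitmx by rewrite unitmx_mul h0 E_unit.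
have iw : abs P <= 1 by exact: abs_nat_le1.
split.
- exact: rep_is_lattice h0 (homothetic_refl _).
- exact: rep_is_lattice e0 (homothetic_refl _).
- move/homotheticP => /(_ h0 e0)/(heq_mul (invmx h)).
  by rewrite mulVmx // mulKmx // -E0 => /heq_E.
exists (lattice_of abs h), (lattice_of abs (h *m E 1)).
split; try exact: homothetic_refl.
  apply/lattice_sub => //; rewrite mulKmx //; apply/mle_mx2.
  by rewrite expr1z abs0 abs1; split.
suff s : lsub (lattice_of abs (P *: h)) (lattice_of abs (h *m E 1)).
  by move=> w /lscale_lattice/s.
apply/lattice_sub => //.
have -> : P *: h = h *m E 1 *m (mx2 P 0 0 1).
  rewrite -mulmxA mx2_mul expr1z !mul0r !mulr0 !addr0 mul1r add0r mulr1 -mx2_scalar.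
  by rewrite mul_mx_scalar.
rewrite mulKmx //; apply/mle_mx2; by rewrite abs0 abs1; split.
Qed.

Lemma adj_E h k : h \in unitmx ->
  adjv p abs (lattice_of abs (h *m E k)) (lattice_of abs (h *m E (k + 1))).
Proof.
move=> h0; rewrite E_add mulmxA; apply: adj_lattice.
by rewrite unitmx_mul h0 E_unit.
Qed.

(** The parity of the valuation of [det h] depends only on the class: a scalar changes the
    determinant by a square and [GLO] by a unit. *)
Lemma type0P h L : h \in unitmx -> rep h L ->
  type0 abs L <-> exists k : int, abs (\det h) = p%:R ^ (k * 2).
Proof.
move=> h0 r; split=> [[g [g0 dg r']]|[k hk]].
  have /(repP g0 h0 r' r)[c [u [c0 [_ du] ->]]] := homothetic_refl L.
  have [k hk] := abs_val c0; exists k.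
  by rewrite detZ absM absX det_mulmx absM dg du !mulr1 hk exprnP exprz_exp.
exists (P ^ k *: h); split.
- by rewrite unitmxZ // unitfE PX_neq0.
- rewrite detZ absM absX abs_PX hk exprnP exprz_exp -expfzDr ?pr_neq0 //.
  by rewrite (_ : _ + _ = 0) ?expr0z //; lia.
exact: rep_heq (heq_scale _ (PX_neq0 _)) r.
Qed.

Lemma type0_hom L M : homothetic L M -> type0 abs L -> type0 abs M.
Proof. by move=> e [g [g0 dg r]]; exists g; split=> //; apply: homothetic_trans r e. Qed.

Lemma type0_mact g L : g \in unitmx -> abs (\det g) = 1 -> type0 abs L ->
  type0 abs (mact g L).
Proof.
move=> g0 dg [h [h0 dh r]]; exists (g *m h); split; last exact: rep_mact.
  by rewrite unitmx_mul g0.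
by rewrite det_mulmx absM dg dh mulr1.
Qed.

Lemma type0_step h h' L L' : h \in unitmx -> h' \in unitmx -> rep h L -> rep h' L' ->
  abs (\det h') = abs (\det h) / p%:R -> type0 abs L' <-> ~ type0 abs L.
Proof.
move=> h0 h0' r r' e; rewrite (type0P h0' r') (type0P h0 r).
have d0 : \det h != 0 by rewrite -unitfE -unitmxE.
have [m hm] := abs_val d0; rewrite e hm -exprN1 -expfzDr ?pr_neq0 //.
split=> [[k /eq_prz hk] [l /eq_prz hl]|n]; first lia.
have [|odd_m] := boolP (m %% 2 == 0)%Z => [ev|].
  case: n; exists (m %/ 2)%Z; congr (_ ^ _); lia.
exists ((m - 1) %/ 2)%Z; congr (_ ^ _); lia.
Qed.

Lemma adjv_type0 L L' : adjv p abs L L' -> type0 abs L' <-> ~ type0 abs L.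
Proof.
move=> a; have [/is_lattice_rep[h h0 r] _ _ _] := a.
have key n : abs (\det n) = p%:R^-1 -> rep (h *m n) L' -> type0 abs L' <-> ~ type0 abs L.
  move=> dn r'; apply: type0_step r r' _ => //.
    rewrite unitmx_mul h0 unitmxE unitfE -abs_eq0 dn invr_eq0; exact: pr_neq0.
  by rewrite det_mulmx absM dn.
case: (neighbour h0 r a) => [[t _]|]; apply: key;
  by rewrite det_mx2 ?mul0r ?mulr0 ?mulr1 ?mul1r subr0 abs_P.
Qed.

(** For integral [t], this unipotent matrix thus fixes the classes of [E j] for all [j <= k]. *)
Lemma lower_E (t : K) (k j : int) :
  mx2 1 0 (P ^ k * t) 1 *m E j = E j *m mx2 1 0 (P ^ (k - j) * t) 1.
Proof.
rewrite !mx2_mul; congr mx2; rewrite ?(mul0r, mulr0, mul1r, mulr1, addr0, add0r) //.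
by rewrite mulrA -expfzDr ?P_neq0 // addrC subrK.
Qed.

Lemma lower_GLO t : abs t <= 1 -> GLO (mx2 1 0 t 1).
Proof.
move=> ht; split; last by rewrite det_mx2 mulr1 mul0r subr0 abs1.
by apply/mle_mx2; rewrite abs1 abs0; split.
Qed.

Lemma abs_PX_le1 (k : int) : 0 <= k -> abs (P ^ k) <= 1.
Proof. by move=> k0; rewrite abs_PX -(expr0z (p%:R : rat)) ler_prz oppr_le0. Qed.

(** Induction on the length: the next vertex differs from the straight continuation by a unipotent
    matrix that fixes all earlier vertices, so it can be absorbed into [h]. *)
Lemma path_std (f : nat -> vsetT K) n :
  (forall k, (k <= n)%N -> adjv p abs (f k) (f k.+1)) ->
  (forall k, (k < n)%N -> ~ homothetic (f k) (f k.+2)) ->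
  exists2 h, h \in unitmx & forall k : nat, (k <= n.+1)%N -> rep (h *m E k) (f k).
Proof.
elim: n => [|n IH] ha hn.
  have [/is_lattice_rep[h h0 r] _ _ _] := ha 0%N isT.
  have fin j : GLO j -> rep (h *m j *m E 1) (f 1%N) ->
      exists2 h, h \in unitmx & forall k : nat, (k <= 1)%N -> rep (h *m E k) (f k).
    move=> hj r1; exists (h *m j); first by rewrite unitmx_mul h0 GLO_unit.
    case=> [|[|//]] _ //; rewrite E0 mulmx1; exact: rep_heq (heq_GLO _ hj) r.
  case: (neighbour h0 r (ha 0%N isT)) => [[t t1 rt]|rt].
    apply: (fin _ (lower_GLO t1)).
    rewrite -mulmxA (_ : _ *m E 1 = mx2 1 0 t P) //.
    by rewrite mx2_mul expr1z; congr mx2; ring.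
  (* The first edge has no forbidden direction; exchanging the basis vectors turns [diag(P, 1)] into
     [E 1]. *)
  have hj : GLO (mx2 0 1 1 0).
    split; last by rewrite det_mx2 mul0r sub0r mul1r absN abs1.
    by apply/mle_mx2; rewrite abs0 abs1; split.
  apply: (fin _ hj); apply: rep_heq rt.
  rewrite -mulmxA; apply: heq_mul.
  rewrite (_ : _ *m E 1 = mx2 P 0 0 1 *m mx2 0 1 1 0); first exact: heq_GLO.
  by rewrite !mx2_mul expr1z; congr mx2; ring.
have [||h h0 r] := IH; try by move=> k kn; first [apply: ha|apply: hn]; lia.
have hu k : h *m E k \in unitmx by rewrite unitmx_mul h0 E_unit.
have := neighbour (hu _) (r n.+1 (leqnn _)) (ha n.+1 (leqnn _)).
case=> [[t t1 rt]|rt]; last first.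
  (* The neighbour [diag(P, 1)] of [E n.+1] is [P *: E n], that is, a step back. *)
  case: (hn n (leqnn _)); apply/(repP (hu _) (hu _) (r n (leqnSn _))); last first.
    exact: heq_refl.
  apply: rep_heq rt; rewrite -mulmxA.
  rewrite (_ : _ *m mx2 _ _ _ _ = P *: E n).
    by rewrite -scalemxAr; apply/heq_sym/heq_scale/P_neq0.
  rewrite mx2_mul mx2_scale exprSz.
  by congr mx2; ring.
set U := mx2 1 0 (P ^ n.+1 * t) 1.
have hU : GLO U by apply: lower_GLO; rewrite abs_mul_le1 // abs_PX_le1.
exists (h *m U); first by rewrite unitmx_mul h0 GLO_unit.
move=> k; rewrite leq_eqVlt ltnS => /orP[/eqP->|kn].
  rewrite -mulmxA (_ : U *m E _ = E n.+1 *m mx2 1 0 t P) ?mulmxA //.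
  rewrite !mx2_mul !exprSz.
  by congr mx2; ring.
rewrite -mulmxA lower_E mulmxA; apply: rep_heq (r k kn).
apply: heq_GLO; apply: lower_GLO; apply: abs_mul_le1 => //; apply: abs_PX_le1; lia.
Qed.

Lemma mle_scale e f c A : abs c <= e -> mle f A -> mle (e * f) (c *: A).
Proof. by move=> hc hA i j; rewrite mxE abs_mul_le. Qed.

(** Stabilisers of vertices are open: the tolerance [(M * N)^-1] offsets the growth of [u - 1] under
    conjugation by [h]. *)
Lemma small_stab (hs : seq 'M[K]_2) : (forall h, h \in hs -> h \in unitmx) ->
  exists2 e : rat, 0 < e & forall u, \det u = 1 -> mle e (u - 1%:M) ->
    forall h, h \in hs -> heq h (u *m h).
Proof.
elim: hs => [|h hs IH] hu; first by exists 1.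
have [|e e0 he] := IH; first by move=> k kh; apply: hu; rewrite inE kh orbT.
have h0 : h \in unitmx by apply: hu; rewrite mem_head.
have [M M1 hM] := mle_bound h; have [N N1 hN] := mle_bound (invmx h).
exists (Num.min e (M * N)^-1).
  by rewrite lt_min e0 invr_gt0 mulr_gt0 // (lt_le_trans ltr01).
move=> u du su k; rewrite inE => /orP[/eqP->|]; last first.
  by apply: he => //; apply: mle_trans su; rewrite ge_min lexx.
have {}su : mle (M * N)^-1 (u - 1%:M) by apply: mle_trans su; rewrite ge_min lexx orbT.
have -> : u *m h = h *m (invmx h *m u *m h) by rewrite !mulmxA mulmxV // mul1mx.
apply: heq_GLO; split; last first.
  by rewrite !det_mulmx du mulr1 det_inv mulVf ?abs1 // -unitfE -unitmxE.
have -> : invmx h *m u *m h = invmx h *m (u - 1%:M) *m h + 1%:M.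
  by rewrite mulmxBr mulmxBl mulmx1 mulVmx // subrK.
apply: mle_add mle1_1.
have := mle_mul (mle_mul hN su) hM.
rewrite (_ : N * (M * N)^-1 * M = 1) //; have [m0 n0] : M != 0 /\ N != 0 by split; lra.
by field; rewrite m0 n0.
Qed.

(** * Density of the norm-one group *)

Variables (a b : rat) (phi : quat K -> 'M[K]_2).
Hypothesis Hphi : splitting_iso a b iota phi.

Let phiD : forall x y, phi (qadd x y) = phi x + phi y. Proof. by case: Hphi. Qed.
Let phiZ : forall c x, phi (qscale c x) = c *: phi x. Proof. by case: Hphi. Qed.
Let phiM : forall x y, phi (qmul (iota a) (iota b) x y) = phi x *m phi y.
Proof. by case: Hphi. Qed.
Let phi1 : phi (qone K) = 1%:M. Proof. by case: Hphi. Qed.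
Let phi_bij : bijective phi. Proof. by case: Hphi. Qed.

Local Notation gm := (gmat iota phi).

Lemma two_neq0 : (2%:R : K) != 0.
Proof. by rewrite -(rmorph_nat iota) fmorph_eq0. Qed.

(* [phi u] squares to a scalar; by Cayley-Hamilton a non-zero trace would make [phi u], hence
   [u], scalar. *)
Lemma phi_pure u : q1 u = 0 ->
  \tr (phi u) = 0 /\ \det (phi u) = qnorm (iota a) (iota b) u.
Proof.
case: u => [x1 x2 x3 x4] /= ->; set u := Quat _ _ _ _; set N := qnorm _ _ _.
have e : phi u *m phi u = (- N)%:M.
  rewrite -phiM -[RHS]scalemx1 -phi1 -phiZ; congr phi.
  by rewrite /qmul /qscale /N /qnorm /=; congr Quat; ring.
have := cayley_hamilton2 (phi u); rewrite e => ch.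
have tM : \tr (phi u) *: phi u = (\det (phi u) - N)%:M.
  by rewrite raddfD /= ch addrC subrK.
have t0 : \tr (phi u) = 0.
  apply/eqP; apply/negPn/negP => t0.
  set s := (\tr (phi u))^-1 * (\det (phi u) - N).
  have es : phi u = phi (qscale s (qone K)).
    by rewrite phiZ phi1 scalemx1 /s -scale_scalar_mx -tM scalerA mulVf // scale1r.
  have /(congr1 (@q1 K)) /= : u = qscale s (qone K) by apply: bij_inj es.
  rewrite mulr1 => s0; move: t0; rewrite es -s0 phiZ scale0r mxtrace0 eqxx //.
split=> //; move/eqP: tM; rewrite t0 scale0r eq_sym => /eqP/matrixP/(_ 0 0).
by rewrite !mxE /= => /eqP; rewrite subr_eq0 => /eqP.
Qed.

Lemma phi_split x : exists2 u, q1 u = 0 & phi x = (q1 x)%:M + phi u /\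
  qnorm (iota a) (iota b) x = q1 x ^+ 2 + qnorm (iota a) (iota b) u.
Proof.
exists (Quat 0 (q2 x) (q3 x) (q4 x)) => //; split; last by rewrite /qnorm /=; ring.
rewrite -scalemx1 -phi1 -phiZ -phiD; congr phi.
by case: x => *; rewrite /qadd /qscale /=; congr Quat; ring.
Qed.

Lemma phi_det x : \det (phi x) = qnorm (iota a) (iota b) x.
Proof.
have [u u0 [-> ->]] := phi_split x; have [] := phi_pure u0.
case: (phi u) / (mx2P (phi u)) => y z w v; rewrite !mx2s => t0 <-.
by have -> : v = - y; [apply/eqP; rewrite -addr_eq0 addrC t0|ring].
Qed.

Lemma phi_tr x : \tr (phi x) = 2%:R * q1 x.
Proof.
have [u u0 [-> _]] := phi_split x; have [t0 _] := phi_pure u0.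
by rewrite raddfD /= t0 addr0 mxtrace_scalar mulr_natl.
Qed.

Lemma gmatM x y : gm (qmul a b x y) = gm x *m gm y.
Proof.
rewrite /gmat -phiM; congr phi; rewrite /qmul /qmap /=.
by rewrite !(rmorphD, rmorphN, rmorphM).
Qed.

Lemma gmatD x y : gm (qadd x y) = gm x + gm y.
Proof. by rewrite /gmat -phiD; congr phi; rewrite /qadd /qmap /= !rmorphD. Qed.

Lemma gmatZ c x : gm (qscale c x) = iota c *: gm x.
Proof. by rewrite /gmat -phiZ; congr phi; rewrite /qscale /qmap /= !rmorphM. Qed.

Lemma gmat1 : gm (qone rat) = 1%:M.
Proof. by rewrite /gmat -phi1; congr phi; rewrite /qone /qmap /= !rmorph0 rmorph1. Qed.

Lemma gmat_det x : \det (gm x) = iota (qnorm a b x).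
Proof.
rewrite phi_det /qnorm /qmap /=.
by rewrite !(rmorphD, rmorphN, rmorphM, rmorphXn).
Qed.

Lemma gmat_tr x : \tr (gm x) = iota (2%:R * q1 x).
Proof. by rewrite phi_tr rmorphM rmorph_nat. Qed.

Lemma gmat_det1 x : normone a b x -> \det (gm x) = 1.
Proof. by rewrite gmat_det => ->; rewrite rmorph1. Qed.

Lemma gmat_unit x : normone a b x -> gm x \in unitmx.
Proof. by move=> /gmat_det1 dx; rewrite unitmxE dx unitr1. Qed.

Lemma phi_basis x : phi x = q1 x *: 1%:M + q2 x *: phi (Quat 0 1 0 0)
  + q3 x *: phi (Quat 0 0 1 0) + q4 x *: phi (Quat 0 0 0 1).
Proof.
rewrite -phi1 -!phiZ -!phiD; congr phi.
by case: x => *; rewrite /qadd /qscale /=; congr Quat; ring.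
Qed.

(** By linearity of [phi] it suffices to approximate four coordinates; the bounds of the basis
    matrices set the precision. *)
Lemma gmat_dense Z e : 0 < e -> exists z, mle e (gm z - Z).
Proof.
move=> e0; have [psi _ phiK] := phi_bij; rewrite -[Z]phiK; set x := psi Z.
have [M1 M11 h1] := mle_bound (1%:M); have [M2 M21 h2] := mle_bound (phi (Quat 0 1 0 0)).
have [M3 M31 h3] := mle_bound (phi (Quat 0 0 1 0)).
have [M4 M41 h4] := mle_bound (phi (Quat 0 0 0 1)).
have near t M : 1 <= M -> exists q, abs (iota q - t) <= e / M.
  move=> M_1; have [|q hq] := @abs_dense t (e / M).
    by rewrite divr_gt0 // (lt_le_trans ltr01).
  by exists q; rewrite -absN opprB ltW.
have [z1 d1] := near (q1 x) _ M11; have [z2 d2] := near (q2 x) _ M21.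
have [z3 d3] := near (q3 x) _ M31; have [z4 d4] := near (q4 x) _ M41.
exists (Quat z1 z2 z3 z4); rewrite /gmat [phi x]phi_basis phi_basis /=.
rewrite !opprD !addrA [X in mle _ X](_ : _ = (iota z1 - q1 x) *: 1%:M
  + (iota z2 - q2 x) *: phi (Quat 0 1 0 0) + (iota z3 - q3 x) *: phi (Quat 0 0 1 0)
  + (iota z4 - q4 x) *: phi (Quat 0 0 0 1)).
  have sc M c A : 1 <= M -> mle M A -> abs c <= e / M -> mle e (c *: A).
    move=> M_1 hA hc; have := mle_scale hc hA; rewrite divfK //; lra.
  apply: mle_add; last exact: (sc _ _ _ M41 h4 d4).
  apply: mle_add; last exact: (sc _ _ _ M31 h3 d3).
  by apply: mle_add; [exact: (sc _ _ _ M11 h1 d1)|exact: (sc _ _ _ M21 h2 d2)].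
by rewrite !scalerBl; apply/matrixP => i j; rewrite !mxE; ring.
Qed.

(** This element is [z / zbar]: a rational quaternion is brought to norm one without extracting a
    square root. *)
Lemma normone_sqr z : qnorm a b z != 0 ->
  normone a b (qscale (qnorm a b z)^-1 (qmul a b z z)).
Proof.
move=> Nz0.
rewrite /normone [LHS](_ : _ = (qnorm a b z)^-1 ^+ 2 * qnorm a b z ^+ 2); first by field.
by rewrite /qnorm /qscale /qmul /=; ring.
Qed.

(* Since [g] has determinant 1, Cayley-Hamilton gives [(1 + g)^2 = det(1 + g) g]: a rational
   [z] close to [1 + g] yields the norm-one element [z^2 / N(z)] close to [g]. *)
Lemma approx_generic g (hs : seq 'M[K]_2) : \det g = 1 -> 2%:R + \tr g != 0 ->
  (forall h, h \in hs -> h \in unitmx) ->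
  exists x, normone a b x /\ forall h, h \in hs -> heq (g *m h) (gm x *m h).
Proof.
move=> dg tg hu; set Z := 1%:M + g.
have dZ : \det Z = 2%:R + \tr g.
  move: dg; rewrite /Z; case: g / (mx2P g) {tg Z} => x y z w; rewrite !mx2s => dg.
  by have -> : 2%:R + (x + w) = 1 + (x + w) + (x * w - y * z); [rewrite dg|]; ring.
have ZZ : Z *m Z = \det Z *: g.
  rewrite dZ /Z mulmxDl !mulmxDr !mul1mx mulmx1 cayley_hamilton2 dg scalerDl.
  by rewrite scaler_nat; apply/matrixP => i j; rewrite !mxE; ring.
have Z0 : Z \in unitmx by rewrite unitmxE unitfE dZ.
have [e e0 he] := small_stab hu.
have [M M1 hM] := mle_bound Z; have [N N1 hN] := mle_bound (invmx Z).
have [MN1 M0 N0] : [/\ 1 <= N * M, M != 0 & N != 0].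
  by split; rewrite ?mulr_ege1 // gt_eqF // (lt_le_trans ltr01).
(* The factor [N * M] pays for conjugation by [Z]; the bound [2^-1] forces [abs (\det v - 1) < 1],
   so [det v] is a unit. *)
pose d := Num.min e 2%:R^-1 / (N * M).
have m0 : 0 < Num.min e 2%:R^-1 by rewrite lt_min e0.
have d0 : 0 < d by rewrite divr_gt0 // (lt_le_trans ltr01).
have d2 : d <= Num.min e 2%:R^-1.
  by rewrite /d ler_pdivrMr ?(lt_le_trans ltr01) // ler_peMr // ltW.
have [d3 d4] : d <= e /\ d <= 2%:R^-1 by move: d2; rewrite le_min => /andP.
have [|z hz] := @gmat_dense Z (d / N); first by rewrite divr_gt0 // (lt_le_trans ltr01).
have [v vE] : exists v, v = invmx Z *m gm z by eexists.
have Zv : gm z = Z *m v by rewrite vE mulmxA mulmxV // mul1mx.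
have hv : mle d (v - 1%:M).
  have -> : v - 1%:M = invmx Z *m (gm z - Z) by rewrite mulmxBr mulVmx // vE.
  by have := mle_mul hN hz; rewrite mulrC divfK.
have dv1 : abs (\det v - 1) <= d.
  rewrite (_ : v = (v - 1%:M) + 1%:M); last by rewrite subrK.
  case: (v - 1%:M) / (mx2P (v - 1%:M)) hv => x y z' w /mle_mx2[h1 h2 h3 h4].
  rewrite !mx2s (_ : _ - 1 = x + w + (x * w - y * z')); last by ring.
  have dd : d * d <= d by nra.
  apply: absD; first exact: absD.
  by apply: absB; apply: le_trans dd; apply: abs_mul_le.
have dv : abs (\det v) = 1.
  have lt1 : abs (\det v - 1) < abs 1 by rewrite abs1; lra.
  by have := absDl lt1; rewrite addrC subrK abs1.
have dv0 : \det v != 0 by rewrite -abs_eq0 dv oner_neq0.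
have v1 : mle 1 v.
  rewrite (_ : v = (v - 1%:M) + 1%:M); last by rewrite subrK.
  by apply: mle_add mle1_1; apply: mle_trans hv; lra.
(* Chosen so that [z^2 / N(z) = g u]: indeed [z^2 = Z v Z v = Z^2 (Z^-1 v Z v)] and
   [Z^2 = det Z * g]. *)
set u := (\det v)^-1 *: (invmx Z *m v *m Z *m v).
have du : \det u = 1.
  rewrite detZ !det_mulmx det_inv; field.
  by rewrite -unitfE -unitmxE Z0.
have su : mle e (u - 1%:M).
  have -> : u - 1%:M = (\det v)^-1 *: (invmx Z *m (v - 1%:M) *m (Z *m v)
             + (v - 1%:M) + (1 - \det v)%:M).
    rewrite mulmxBr mulmx1 mulmxBl [invmx Z *m (Z *m v)]mulmxA mulVmx // mul1mx.
    rewrite addrA subrK raddfB /= addrA subrK scalerBr /u -!mulmxA; congr (_ - _).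
    by rewrite scale_scalar_mx mulVf.
  rewrite -[e]mul1r; apply: mle_scale; first by rewrite absV dv invr1.
  apply: mle_add; [apply: mle_add|].
  - have := mle_mul (mle_mul hN hv) (mle_mul hM v1); apply: mle_trans.
    rewrite mulr1 /d (_ : _ * M = Num.min e 2%:R^-1) ?ge_min ?lexx //.
    by field; rewrite M0.
  - exact: mle_trans hv.
  rewrite mx2_scalar; apply/mle_mx2; rewrite abs0 -absN opprB.
  by split; lra.
have Nz : \det (gm z) = \det Z * \det v.
  by rewrite -det_mulmx Zv.
have Nz0 : qnorm a b z != 0.
  by rewrite -(fmorph_eq0 iota) -gmat_det Nz mulf_neq0 // -unitfE -unitmxE.
exists (qscale (qnorm a b z)^-1 (qmul a b z z)); split; first exact: normone_sqr.
move=> h hh; rewrite gmatZ gmatM fmorphV -gmat_det Nz.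
have -> : (\det Z * \det v)^-1 *: (gm z *m gm z) *m h = g *m (u *m h).
  rewrite Zv invfM -scalerA /u -!scalemxAl -!scalemxAr.
  rewrite (_ : g = (\det Z)^-1 *: (Z *m Z)); last first.
    by rewrite ZZ scalerA mulVf ?scale1r // -unitfE -unitmxE.
  rewrite -!scalemxAl [in RHS]scalerA [in LHS]scalerA [in RHS]mulrC; congr (_ *: _).
  by rewrite !mulmxA mulmxK.
apply: heq_mul; exact: he.
Qed.

(** If [tr g = -2], then [- g] has trace 2 and acts on homothety classes as [g] does. *)
Lemma approx g (hs : seq 'M[K]_2) : \det g = 1 -> (forall h, h \in hs -> h \in unitmx) ->
  exists x, normone a b x /\ forall h, h \in hs -> heq (g *m h) (gm x *m h).
Proof.
move=> dg hu; have [t0|] := eqVneq (2%:R + \tr g) 0; last by move=> t0; apply: approx_generic.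
have [||//|x [nx hx]] := @approx_generic (- g) hs.
- by rewrite -scaleN1r detZ dg sqrrN expr1n mulr1.
- rewrite raddfN /= (_ : _ - _ = 2%:R * 2%:R) ?mulf_neq0 ?two_neq0 //.
  by move/eqP: t0; rewrite addr_eq0 => /eqP <-; ring.
exists x; split=> // h hh; apply: heq_trans (hx h hh).
by rewrite mulNmx -scaleN1r; apply: heq_scale; rewrite oppr_eq0 oner_neq0.
Qed.

Lemma normone_mul x y : normone a b x -> normone a b y -> normone a b (qmul a b x y).
Proof.
rewrite /normone => nx ny; rewrite -[RHS]mulr1 -{1}nx -ny.
by rewrite /qnorm /qmul /=; ring.
Qed.

Definition qconj (x : quat rat) := Quat (q1 x) (- q2 x) (- q3 x) (- q4 x).

Lemma normone_conj x : normone a b x -> normone a b (qconj x).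
Proof. by rewrite /normone /qnorm /= !sqrrN. Qed.

Lemma gmat_conj x : normone a b x -> gm (qconj x) = invmx (gm x).
Proof.
move=> nx; have x0 := gmat_unit nx; apply: (can_inj (mulKmx x0)).
rewrite mulmxV // -gmatM -gmat1; congr (gm _).
rewrite /qmul /= /qone -nx /qnorm; congr Quat; ring.
Qed.

Lemma normone1 : normone a b (qone rat).
Proof. by rewrite /normone /qnorm /=; ring. Qed.

(** * Galleries and Weyl transitivity *)

(** The vertex that [i]-adjacent chambers share, so that both types are handled by one argument. *)
Definition side (i : bool) (C : chamber K) : vsetT K := if i then C.1 else C.2.

Lemma ch_eq_side (C D : chamber K) : (forall i, homothetic (side i C) (side i D)) <-> ch_eq C D.
Proof. by split=> [h|[h1 h2] []] //; split; [apply: (h true)|apply: (h false)]. Qed.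

Lemma ch_eq_sidel i (C D : chamber K) : homothetic (side i C) (side i D) ->
  homothetic (side (~~ i) C) (side (~~ i) D) -> ch_eq C D.
Proof. by case: i => h1 h2; split. Qed.

Lemma ch_eq_sym (C D : chamber K) : ch_eq C D -> ch_eq D C.
Proof. by move=> [h1 h2]; split; apply: homothetic_sym. Qed.

Lemma ch_eq_trans (C D F : chamber K) : ch_eq C D -> ch_eq D F -> ch_eq C F.
Proof.
move=> [h1 h2] [h3 h4]; split; first exact: homothetic_trans h1 h3.
exact: homothetic_trans h2 h4.
Qed.

Lemma is_chamber_eq (C D : chamber K) : ch_eq C D -> is_chamber p abs C -> is_chamber p abs D.
Proof.
move=> [h1 h2] [t1 t2 a12]; split; [exact: type0_hom h1 t1| |exact: adjv_hom a12].
by move=> /(type0_hom (homothetic_sym h2)).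
Qed.

Lemma is_chamber_adjv i C : is_chamber p abs C -> adjv p abs (side (~~ i) C) (side i C).
Proof. by case: i => -[_ _ h] //=; apply: adjv_sym. Qed.

Lemma is_chamber_type i C : is_chamber p abs C -> type0 abs (side i C) <-> i.
Proof. by case: i => -[h1 h2 _]. Qed.

Lemma cadjP i C D : cadj p abs i C D <-> [/\ is_chamber p abs C, is_chamber p abs D,
  ~ ch_eq C D & homothetic (side i C) (side i D)].
Proof. by case: i. Qed.

Lemma cadj_eql i C C' D : ch_eq C C' -> cadj p abs i C D -> cadj p abs i C' D.
Proof.
move=> e /cadjP[hC hD n s]; apply/cadjP; split=> //.
- exact: is_chamber_eq e hC.
- by move=> h; apply: n; apply: ch_eq_trans e h.
by apply: homothetic_trans s; move/ch_eq_side: (ch_eq_sym e).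
Qed.

(* Two consecutive equal letters could be shortened to one letter or none. *)
Lemma weyl_dist_alt C D w : weyl_dist p abs C D w ->
  forall k, (k.+1 < size w)%N -> nth false w k.+1 = ~~ nth false w k.
Proof.
move=> [[c [c0 cn hc]] hmin] k kw.
have [e|ne] := eqVneq (nth false w k.+1) (nth false w k); last first.
  by move: ne; case: (nth _ _ _); case: (nth _ _ _).
have /cadjP[ch0 _ n01 s01] := hc k (ltnW kw).
have /cadjP[_ ch2 n12 s12] := hc _ kw.
rewrite e in s12; have s02 := homothetic_trans s01 s12.
(* Deleting [d] letters after position [k] contradicts minimality. The first premise at [j = 0] is
   the splice itself, the second covers a splice at the end of the gallery. *)
have cut d : (0 < d)%N -> (k + d <= size w)%N -> (forall j, (k + d + j < size w)%N ->
      cadj p abs (nth false w (k + d + j)%N) (if j is 0 then c k else c (k + d + j)%N)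
        (c (k + d + j).+1%N)) ->
    ((k + d)%N = size w -> ch_eq (c k) (c (k + d)%N)) -> False.
  move=> d0 kd h1 h2; set w' := take k w ++ drop (k + d) w.
  have sw' : size w' = (size w - d)%N.
    by rewrite size_cat size_take size_drop; case: ifP; lia.
  have := hmin w'; rewrite sw' => /(_ _); suff: gallery p abs C D w' by move=> g /(_ g); lia.
  exists (fun j => if (j <= k)%N then c j else c (j + d)%N); rewrite sw'; split=> //.
    case: leqP => h; last by rewrite subnK //; lia.
    have {}h : (k + d)%N = size w by lia.
    rewrite -h addnK; apply: ch_eq_trans (h2 h) _; by rewrite h.
  move=> j jw; rewrite nth_cat size_takel; last by lia.
  case: (ltngtP j k) => jk.
  - by rewrite nth_take //; apply: hc; lia.
  - have := h1 (j - k)%N; rewrite (_ : k + d + (j - k) = j + d)%N; last by lia.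
    rewrite nth_drop (_ : k + d + (j - k) = j + d)%N; last by lia.
    rewrite addSn; have := subn_gt0 k j; rewrite jk; case: (j - k)%N => // m _; apply; lia.
  have := h1 0%N; rewrite nth_drop jk subnn addn0 addSn; apply; lia.
case: (classic (ch_eq (c k) (c k.+2))) => e02; exfalso.
  apply: (cut 2%N) => //; rewrite ?addn2 // => -[|j] hj; last by apply: hc.
  rewrite addn0 in hj *; exact: cadj_eql (ch_eq_sym e02) (hc _ hj).
apply: (cut 1%N) => //; rewrite ?addn1 //; [exact: ltnW| |lia].
move=> [|j] hj; last exact: hc.
by rewrite addn0 e; apply/cadjP; split.
Qed.

(** An alternating gallery follows a path without backtracking, which [path_std] straightens: [C] is
    the edge from 0 to 1, [D] the edge from [n] to [n + 1]. For the empty word the default [false]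
    merely orients the common edge. *)
Lemma weyl_dist_std C D w : is_chamber p abs C -> weyl_dist p abs C D w ->
  let i := nth false w 0 in let n := size w in
  exists h, [/\ h \in unitmx,
    rep (h *m E 0) (side (~~ i) C), rep (h *m E 1) (side i C),
    rep (h *m E n) (side (~~ (i (+) odd n)) D) &
    rep (h *m E (n.+1)%:Z) (side (i (+) odd n) D)].
Proof.
move=> hC wd i n; have alt := weyl_dist_alt wd; have [[c [c0 cn hc]] _] := wd.
have wk k : (k < n)%N -> nth false w k = i (+) odd k.
  elim: k => [|k IH] kn; first by rewrite addbF.
  by rewrite alt // IH ?addbN // ltnW.
have chk k : (k <= n)%N -> is_chamber p abs (c k).
  case: k => [|k] kn; first exact: is_chamber_eq (ch_eq_sym c0) hC.
  by have /cadjP[] := hc k kn.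
pose s k := i (+) odd k.
(* [f k.+1] is the vertex shared by [c k] and [c k.+1]; [f 0] and [f n.+1] are the free ends. *)
pose f k := if (k <= n)%N then side (~~ s k) (c k) else side (s n) (c n).
have f1 k : (k <= n)%N -> homothetic (side (s k) (c k)) (f k.+1).
  rewrite leq_eqVlt => /orP[/eqP->|kn]; first by rewrite /f ltnn; apply: homothetic_refl.
  have /cadjP[_ _ _] := hc k kn; rewrite wk // /f kn /s /= addbN negbK; exact.
have f0 k : (k <= n)%N -> f k = side (~~ s k) (c k) by rewrite /f => ->.
have [k kn|k1 kn e|h h0 r] := @path_std f n.
- rewrite f0 //; apply: adjv_hom (homothetic_refl _) (f1 _ kn) _.
  exact: is_chamber_adjv (chk _ kn).
- have /cadjP[_ _ nch sk] := hc k1 kn; apply: nch.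
  apply: (ch_eq_sidel (i := s k1)); first by rewrite wk in sk.
  rewrite f0 ?(ltnW kn) // in e; apply: homothetic_trans e _; apply: homothetic_sym.
  by have := f1 _ kn; rewrite /s /= addbN.
exists h; split=> //.
- have := r 0%N isT; rewrite f0 // /s addbF; apply: rep_hom.
  by move/ch_eq_side: c0.
- have := r 1%N isT; apply: rep_hom; apply: homothetic_trans (homothetic_sym (f1 0%N _)) _ => //.
  by rewrite /s addbF; move/ch_eq_side: c0.
- have := r n (leqnSn _); rewrite f0 //; apply: rep_hom.
  by move/ch_eq_side: cn.
have := r n.+1 (leqnn _); apply: rep_hom; apply: homothetic_trans (homothetic_sym (f1 n _)) _ => //.
by move/ch_eq_side: cn.
Qed.

Lemma same_type h h' L L' : h \in unitmx -> h' \in unitmx -> rep h L -> rep h' L' ->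
  (type0 abs L <-> type0 abs L') ->
  exists2 c, c != 0 & abs (\det h) = abs c ^+ 2 * abs (\det h').
Proof.
move=> h0 h0' r r'; rewrite (type0P h0 r) (type0P h0' r').
have d0 : \det h != 0 by rewrite -unitfE -unitmxE.
have d0' : \det h' != 0 by rewrite -unitfE -unitmxE.
have [m hm] := abs_val d0; have [n hn] := abs_val d0'; rewrite hm hn => e.
suff [k hk] : exists k, m = k * 2 + n.
  exists (P ^ (- k)); first exact: PX_neq0.
  by rewrite abs_PX opprK exprnP exprz_exp -expfzDr ?pr_neq0 // hk.
have ev j : (exists k : int, (p%:R : rat) ^ j = p%:R ^ (k * 2)) <-> (j %% 2 = 0)%Z.
  split=> [[k /eq_prz]|hj]; first lia.
  exists (j %/ 2)%Z; congr (_ ^ _); lia.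
exists ((m - n) %/ 2)%Z; move: e; rewrite !ev; lia.
Qed.

(** The matrix [c h' diag(1, d) h^-1] carries one line to the other. The unit [d] corrects its
    determinant to 1 and does not disturb the line, as [diag(1, d)] commutes with [E k]. *)
Lemma approx_std h h' c (ks : seq int) : h \in unitmx -> h' \in unitmx -> c != 0 ->
  abs (\det h) = abs c ^+ 2 * abs (\det h') ->
  exists x, normone a b x /\
    forall k, k \in ks -> heq (h' *m E k) (gm x *m (h *m E k)).
Proof.
move=> h0 h0' c0 e.
have d0 : \det h != 0 by rewrite -unitfE -unitmxE.
have d0' : \det h' != 0 by rewrite -unitfE -unitmxE.
set d := \det h / (c ^+ 2 * \det h').
have d1 : abs d = 1.
  by rewrite absM absV absM absX -e divff // abs_eq0.
set g := c *: (h' *m mx2 1 0 0 d *m invmx h).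
have dg : \det g = 1.
  rewrite detZ !det_mulmx det_mx2 det_inv mul1r mulr0 subr0 /d.
  by field; rewrite d0 d0' c0.
have [|x [nx hx]] := @approx g [seq h *m E k | k <- ks] dg.
  by move=> _ /mapP[k _ ->]; rewrite unitmx_mul h0 E_unit.
exists x; split=> // k kk; apply: heq_trans _ (hx _ (map_f _ kk)).
rewrite -!scalemxAl mulmxA mulmxKV //.
have -> : h' *m mx2 1 0 0 d *m E k = h' *m E k *m mx2 1 0 0 d.
  by rewrite -!mulmxA !mx2_mul; congr (_ *m mx2 _ _ _ _); ring.
apply: heq_trans (heq_scale _ c0); apply: heq_GLO; split.
  by apply/mle_mx2; rewrite d1 abs0 abs1; split.
by rewrite det_mx2 mul1r mulr0 subr0.
Qed.

(** The pairs lie on two standard lines at the same indices 0, 1, [n], [n + 1], with the same types;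
    approximation at these four indices is enough. *)
Lemma weyl_transitive_G : weyl_transitive a b p iota abs phi.
Proof.
move=> w C1 D1 C2 D2 hC1 hD1 hC2 hD2 w1 w2.
have [h1 [u1 r11 r12 r13 r14]] := weyl_dist_std hC1 w1.
have [h2 [u2 r21 r22 r23 r24]] := weyl_dist_std hC2 w2.
set i := nth false w 0 in r11 r12 r13 r14 r21 r22 r23 r24.
have eE h : h *m E 0 = h by rewrite E0 mulmx1.
have [|||c c0 e] := @same_type h1 h2 (side (~~ i) C1) (side (~~ i) C2) u1 u2.
- by rewrite -[h1]eE.
- by rewrite -[h2]eE.
- by rewrite !is_chamber_type.
have [x [nx hx]] := approx_std [:: 0; 1; (size w)%:Z; (size w).+1%:Z] u1 u2 c0 e.
have fin k L L' : k \in [:: 0; 1; (size w)%:Z; (size w).+1%:Z] ->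
    rep (h1 *m E k) L -> rep (h2 *m E k) L' -> homothetic (mact (gm x) L) L'.
  move=> /hx hk r r'; apply: rep_inj r'; apply: rep_heq (rep_mact (gm x) r).
  exact: heq_sym.
have fin2 l k k' C D : k \in [:: 0; 1; (size w)%:Z; (size w).+1%:Z] ->
    k' \in [:: 0; 1; (size w)%:Z; (size w).+1%:Z] ->
    rep (h1 *m E k) (side (~~ l) C) -> rep (h1 *m E k') (side l C) ->
    rep (h2 *m E k) (side (~~ l) D) -> rep (h2 *m E k') (side l D) ->
    ch_eq (actC iota phi x C) D.
  move=> hk hk' r1 r2 r3 r4.
  have := fin _ _ _ hk r1 r3; have := fin _ _ _ hk' r2 r4.
  by case: l {r1 r2 r3 r4} => /= e1 e2; split.
exists x; split=> //; [apply: fin2 r11 r12 r21 r22|apply: fin2 r13 r14 r23 r24];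
  by rewrite !inE eqxx ?orbT.
Qed.

(** * Lines reflected by the norm-one group *)

Definition line (f : int -> vsetT K) (C : chamber K) : Prop :=
  is_chamber p abs C /\ exists k, (homothetic C.1 (f k) /\ homothetic C.2 (f (k + 1))) \/
    (homothetic C.2 (f k) /\ homothetic C.1 (f (k + 1))).

Lemma edge_chamber L L' : adjv p abs L L' ->
  [/\ is_chamber p abs (L, L'), type0 abs L & ~ type0 abs L'] \/
  [/\ is_chamber p abs (L', L), type0 abs L' & ~ type0 abs L].
Proof.
move=> a0; have t := adjv_type0 a0.
have [t0|t0] := classic (type0 abs L); [left|right].
  have n : ~ type0 abs L' by move=> /t.
  by split.
have t1 : type0 abs L' by apply/t.
by split=> //; split=> //; apply: adjv_sym.
Qed.

(** Each edge goes to an edge of the line, and injectivity forbids turning back, so the values at 0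
    and 1 propagate. With [X] and [f] abstract, the negative half follows by reversing [f]. *)
Lemma flip_half (X : vsetT K -> vsetT K) (f : int -> vsetT K) :
  (forall k l, homothetic (f k) (f l) -> k = l) ->
  (forall L M, homothetic (X L) (X M) -> homothetic L M) ->
  (forall k, exists j, (homothetic (X (f k)) (f j) /\ homothetic (X (f (k + 1))) (f (j + 1)))
     \/ (homothetic (X (f k)) (f (j + 1)) /\ homothetic (X (f (k + 1))) (f j))) ->
  homothetic (X (f 0)) (f 0) -> homothetic (X (f 1)) (f (-1)) ->
  forall n : nat, homothetic (X (f n)) (f (- n%:Z)).
Proof.
move=> finj Xinj he h0 h1 n.
suff [//] : homothetic (X (f n)) (f (- n%:Z)) /\ homothetic (X (f n.+1)) (f (- n.+1%:Z)).
elim: n => [|n [IH1 IH2]]; first by [].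
split=> //; have [j [] [e1 e2]] := he n.+1.
  have jE : - n.+1%:Z = j.
    by apply: finj; apply: homothetic_trans (homothetic_sym IH2) e1.
  have : n%:Z = n.+1%:Z + 1.
    apply/finj/Xinj; apply: homothetic_trans IH1 _; apply: homothetic_sym.
    by rewrite (_ : - n%:Z = j + 1) //; rewrite -jE; lia.
  by lia.
have jE : - n.+1%:Z = j + 1.
  by apply: finj; apply: homothetic_trans (homothetic_sym IH2) e1.
rewrite (_ : Posz n.+2 = n.+1%:Z + 1); last by lia.
by rewrite (_ : - (_ + 1) = j) //; lia.
Qed.

(* In a basis where [f (k - n)] is [E k], [g] exchanges the classes of [E 0] and [E (2n)], which
   forces [|tr g| <= p^-n]. *)
Lemma flip_trace g (f : int -> vsetT K) : \det g = 1 ->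
  (forall k, adjv p abs (f k) (f (k + 1))) ->
  (forall k l, homothetic (f k) (f l) -> k = l) ->
  (forall n : nat, homothetic (mact g (f n)) (f (- n%:Z))) ->
  (forall n : nat, homothetic (mact g (f (- n%:Z))) (f n)) ->
  \tr g = 0.
Proof.
move=> dg fadj finj hpos hneg; apply: small_eq0 => n.
(* The segment from [- (n + 1)] to [n + 1] has [N = 2 n + 2] edges, one more than the argument of
   [path_std]. *)
have [||h h0 r] := @path_std (fun k => f (k%:Z - n.+1%:Z)) (n.+1 + n).
- by move=> k _ /=; rewrite (_ : k.+1%:Z - n.+1%:Z = k%:Z - n.+1%:Z + 1) //; lia.
- by move=> k _ /= /finj; lia.
have rN : rep h (f (- n.+1%:Z)).
  by have := r 0%N isT; rewrite E0 mulmx1 sub0r.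
set N := (n.+1 + n).+1; have rP : rep (h *m E N) (f n.+1).
  by have := r N (leqnn _); rewrite (_ : N%:Z - n.+1%:Z = n.+1) //; lia.
have hu : h *m E N \in unitmx by rewrite unitmx_mul h0 E_unit.
have gu : g \in unitmx by rewrite unitmxE dg unitr1.
set y := invmx h *m g *m h.
have dy : \det y = 1.
  by rewrite !det_mulmx dg mulr1 det_inv mulVf // -unitfE -unitmxE.
have -> : \tr g = \tr y by rewrite /y mxtrace_mulC mulmxA mulmxV // mul1mx.
have [c [u [c0 [hu1 du] ey]]] : heq (E N) y.
  have /(heq_mul (invmx h)) : heq (h *m E N) (g *m h).
    have gh : g *m h \in unitmx by rewrite unitmx_mul gu.
    apply/(repP hu gh rP (rep_mact g rN)); exact: homothetic_sym.
  by rewrite mulKmx // mulmxA.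
have [d [v [d0 [hv1 dv] ez]]] : heq 1%:M (y *m E N).
  have /(heq_mul (invmx h)) : heq h (g *m (h *m E N)).
    have gh : g *m (h *m E N) \in unitmx by rewrite unitmx_mul gu.
    apply/(repP h0 gh rN (rep_mact g rP)); exact: homothetic_sym.
  by rewrite mulVmx // !mulmxA.
have Nk (k : int) : k * 2 = N%:Z -> k = n.+1%:Z by rewrite /N; lia.
(* Determinant 1 fixes the absolute values of the scalars [c] and [d]. Then [y = c (E N u)] bounds
   the lower right entry of [y], and [y E N = d v] the upper left one. *)
have {du} ac : abs c = p%:R ^ n.+1.
  have [k hk] := abs_val c0; rewrite hk; congr (_ ^ _); apply: Nk.
  move: dy; rewrite ey detZ det_mulmx det_E => /(congr1 abs).
  rewrite absM absX absM du mulr1 abs_PX hk exprnP exprz_exp -expfzDr ?pr_neq0 // abs1.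
  rewrite -(expr0z (p%:R : rat)) => /eq_prz; lia.
have {dv} ad : abs d = p%:R ^ (- n.+1%:Z).
  have [k hk] := abs_val d0; rewrite hk; congr (_ ^ _).
  suff /Nk : - k * 2 = N%:Z by lia.
  move/(congr1 (fun z => abs (\det z))): ez; rewrite det_mulmx dy mul1r mul1mx det_E detZ.
  by rewrite abs_PX absM absX dv mulr1 hk exprnP exprz_exp => /eq_prz; lia.
have small : (p%:R : rat) ^ (- n.+1%:Z) <= p%:R ^- n by rewrite exprnN ler_prz; lia.
clearbody y; have y11 : abs (y 1 1) <= p%:R ^- n.
  apply: le_trans small; rewrite ey; case: u / (mx2P u) hu1 {ey} => x1 x2 x3 x4.
  move=> /mle_mx2[_ _ _ h4]; rewrite mx2_mul mx2_scale mx2E mul0r add0r absM absM ac abs_PX.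
  rewrite mulrA -expfzDr ?pr_neq0 // (_ : n.+1%:Z - N%:Z = - n.+1%:Z); last by rewrite /N; lia.
  by rewrite ler_piMr // ltW // exprz_gt0 // pr_gt0.
have y00 : abs (y 0 0) <= p%:R ^- n.
  apply: le_trans small; move: ez; rewrite mul1mx.
  case: y / (mx2P y) {dy ey y11} => x1 x2 x3 x4; case: v / (mx2P v) hv1 => z1 z2 z3 z4.
  move=> /mle_mx2[h1 _ _ _]; rewrite mx2_mul mx2_scale => /mx2_inj[+ _ _ _].
  rewrite mulr1 mulr0 addr0 mx2E => ->; rewrite absM ad.
  by rewrite ler_piMr // ltW // exprz_gt0 // pr_gt0.
by rewrite {1}[y]mx2_eta tr_mx2; apply: absD.
Qed.

Lemma not_strongly_transitive :
  strongly_transitive_some a b p iota abs phi -> sqrt_minus_one a b.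
Proof.
move=> [A [[hap hcov] hinv hst]].
have u1 : (1%:M : 'M[K]_2) \in unitmx by rewrite unitmx1.
have [C0 hC0] : exists C, is_chamber p abs C.
  by case: (edge_chamber (adj_E 0 u1)) => [[]|[]]; eauto.
have [S [AS _ _]] := hcov _ _ hC0 hC0.
have [f [fadj finj hS]] := hap _ AS.
have edge k : exists C, S C /\ ((C = (f k, f (k + 1)) /\ type0 abs (f k)) \/
    (C = (f (k + 1), f k) /\ ~ type0 abs (f k))).
  have r L := homothetic_refl L.
  case: (edge_chamber (fadj k)) => -[hC t1 t2]; eexists.
    split; last by left; split.
    by apply/hS; split=> //; exists k; left.
  split; last by right; split.
  by apply/hS; split=> //; exists k; right.
(* These are the two edges of one line at [f 0]; strong transitivity on that line carries one to the
   other. *)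
have [D0 [SD0 hD0]] := edge 0; have [D1 [SD1 hD1]] := edge (-1).
have [x [nx hx e01]] := hst _ _ _ _ AS SD0 AS SD1.
set X := mact (gmat iota phi x).
have Xinj L M : homothetic (X L) (X M) -> homothetic L M.
  by apply: mact_inj; apply: gmat_unit.
have Xedge k : exists j, (homothetic (X (f k)) (f j) /\ homothetic (X (f (k + 1))) (f (j + 1)))
     \/ (homothetic (X (f k)) (f (j + 1)) /\ homothetic (X (f (k + 1))) (f j)).
  have [C [SC hC]] := edge k; have /hx/hS[_ [j hj]] := SC.
  by case: hC hj => -[-> _] /= [[h1 h2]|[h1 h2]]; exists j; auto.
(* As [f 0] and [f (-1)] have opposite types, the match must fix [f 0] and move [f 1] to
   [f (-1)]. *)
have [X0 X1] : homothetic (X (f 0)) (f 0) /\ homothetic (X (f 1)) (f (-1)).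
  have tt : type0 abs (f 0) <-> ~ type0 abs (f (-1)).
    by have := adjv_type0 (fadj (-1)); rewrite addNr.
  case: hD0 => -[hd0 t0]; case: hD1 => -[hd1 t1]; case: e01;
    rewrite hd0 hd1 addNr add0r /= => e1 e2; try tauto; by split.
have Xm1 : homothetic (X (f (-1))) (f 1).
  have [j] := Xedge (-1); rewrite addNr => -[[h1 h2]|[h1 h2]].
    have j1 : j + 1 = 0 by apply: finj; apply: homothetic_trans (homothetic_sym h2) X0.
    suff : (1 : int) = -1 by [].
    apply/finj/Xinj; apply: homothetic_trans X1 _; apply: homothetic_sym.
    by have {}j1 : j = -1; [lia|rewrite j1 in h1].
  have j0 : j = 0 by apply: finj; apply: homothetic_trans (homothetic_sym h2) X0.
  by move: h1; rewrite j0 add0r.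
have t0 : \tr (gmat iota phi x) = 0.
  apply: (flip_trace (gmat_det1 nx) fadj finj).
    exact: flip_half X0 X1.
  move=> n; suff : homothetic (X (f (- n%:Z))) (f (- - n%:Z)) by rewrite opprK.
  apply: (@flip_half X (fun k => f (- k))); rewrite ?oppr0 ?opprK //.
    by move=> k l /finj; lia.
  move=> k; have [j hj] := Xedge (- (k + 1)).
  have kE : - (k + 1) + 1 = - k by lia.
  rewrite kE in hj; exists (- (j + 1)).
  rewrite opprK (_ : - (- (j + 1) + 1) = j); last by lia.
  by case: hj => -[]; auto.
exists x; move/eqP: t0; rewrite gmat_tr fmorph_eq0 mulf_eq0 /= => /eqP.
case: x nx {hx e01 X Xinj Xedge X0 X1 Xm1} => x1 x2 x3 x4; rewrite /normone /qnorm /= => nx x10.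
rewrite x10 in nx *; rewrite /qmul /qopp /qone /= -nx; congr Quat; ring.
Qed.

(** * Two chambers in a common apartment *)

Lemma upper_GLO t : abs t <= 1 -> GLO (mx2 1 t 0 1).
Proof.
move=> ht; split; last by rewrite det_mx2 mulr1 mulr0 subr0 abs1.
by apply/mle_mx2; rewrite abs1 abs0; split.
Qed.

(** The stabiliser of the standard edge in [GL_2] of the integers: [GLO] fixes [E 0], the second
    clause [E 1]. *)
Definition iwahori u := GLO u /\ heq (E 1) (u *m E 1).

Lemma upper_iwahori t : abs t <= 1 -> iwahori (mx2 1 t 0 1).
Proof.
move=> ht; split; first exact: upper_GLO.
rewrite (_ : _ *m E 1 = E 1 *m mx2 1 (t * P) 0 1).
  by apply: heq_GLO; apply: upper_GLO; rewrite abs_mul_le1 ?abs_nat_le1.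
by rewrite !mx2_mul expr1z; congr mx2; ring.
Qed.

Lemma lower_iwahori t : abs t <= p%:R^-1 -> iwahori (mx2 1 0 t 1).
Proof.
move=> ht; have p1 : (p%:R : rat)^-1 <= 1 by rewrite invf_le1 ?pr_gt0 // ltW ?pr_gt1.
split; first exact: lower_GLO (le_trans ht p1).
have P0 := P_neq0; have := lower_E (t / P) 1 1.
rewrite subrr expr0z mul1r expr1z mulrC divfK // => ->.
by apply: heq_GLO; apply: lower_GLO; rewrite absPV.
Qed.

(** Diagonal matrices translate the standard line, antidiagonal ones ([anti_std]) reflect it; only
    the valuation of the ratio of the entries matters. *)
Lemma diag_std x w l : x != 0 -> abs (w / x) = p%:R ^ (- l) ->
  forall k, heq (E (k + l)) (mx2 x 0 0 w *m E k).
Proof.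
move=> x0 hl k; exists x, (mx2 1 0 0 (w / (x * P ^ l))); split=> //.
  have u1 : abs (w / (x * P ^ l)) = 1.
    by rewrite invfM mulrA absM absV hl abs_PX divff // expfz_neq0 ?pr_neq0.
  split; last by rewrite det_mx2 mul1r mulr0 subr0.
  by apply/mle_mx2; rewrite abs0 abs1 u1.
have Pl0 := PX_neq0 l; rewrite !mx2_mul mx2_scale expfzDr ?P_neq0 //.
by congr mx2; field; rewrite ?x0 ?Pl0.
Qed.

Lemma anti_std y z l : y != 0 -> abs (z / y) = p%:R ^ (- l) ->
  forall k, heq (E (l - k)) (mx2 0 y z 0 *m E k).
Proof.
move=> y0 hl k; exists (y * P ^ k), (mx2 0 1 (z / (y * P ^ l)) 0).
have u1 : abs (z / (y * P ^ l)) = 1.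
  by rewrite invfM mulrA absM absV hl abs_PX divff // expfz_neq0 ?pr_neq0.
have Pl0 := PX_neq0 l; have Pk0 := PX_neq0 k; split.
- by rewrite mulf_neq0.
- split; last by rewrite det_mx2 mul0r sub0r mul1r absN.
  by apply/mle_mx2; rewrite abs0 abs1 u1.
rewrite !mx2_mul mx2_scale expfzDr ?P_neq0 // -invr_expz.
by congr mx2; field; rewrite ?y0 ?Pl0 ?Pk0.
Qed.

Definition monomial2 (n : 'M[K]_2) :=
  (exists x w, [/\ n = mx2 x 0 0 w, x != 0 & w != 0]) \/
  (exists y z, [/\ n = mx2 0 y z 0, y != 0 & z != 0]).

(** Bruhat decomposition relative to the Iwahori subgroup, by elimination around an entry of largest
    absolute value. Upper multipliers need only be integral, lower ones must be divisible by [P];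
    this dictates which comparisons are strict. *)
Lemma bruhat m : m \in unitmx -> exists u v n,
  [/\ iwahori u, iwahori v, m = u *m n *m v & monomial2 n].
Proof.
case: m / (mx2P m) => x y z w; rewrite unitmxE det_mx2 unitfE => d0.
have le1 s t : t != 0 -> abs s <= abs t -> abs (s / t) <= 1.
  by move=> t0 h; rewrite absM absV ler_pdivrMr ?mul1r // abs_gt0.
have lt1 s t : abs s < abs t -> abs (s / t) <= p%:R^-1.
  move=> h; have t0 : t != 0 by rewrite -abs_gt0 (le_lt_trans (abs_ge0 s)).
  by apply: abs_lt1; rewrite absM absV ltr_pdivrMr ?mul1r // abs_gt0.
have nz s t : abs s < abs t -> t != 0.
  by move=> h; rewrite -abs_gt0 (le_lt_trans (abs_ge0 s)).
have pivx : abs z < abs x -> abs y <= abs x -> exists u v n,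
    [/\ iwahori u, iwahori v, mx2 x y z w = u *m n *m v & monomial2 n].
  move=> hz hy; have x0 := nz _ _ hz.
  exists (mx2 1 0 (z / x) 1), (mx2 1 (y / x) 0 1), (mx2 x 0 0 (w - z * y / x)); split.
  - exact/lower_iwahori/lt1.
  - exact/upper_iwahori/le1.
  - by rewrite !mx2_mul; congr mx2; field.
  left; exists x, (w - z * y / x); split=> //; apply: contraNneq d0 => e.
  have -> : x * w - y * z = x * (w - z * y / x) by field.
  by rewrite e mulr0.
have pivw : abs z < abs w -> abs y <= abs w -> exists u v n,
    [/\ iwahori u, iwahori v, mx2 x y z w = u *m n *m v & monomial2 n].
  move=> hz hy; have w0 := nz _ _ hz.
  exists (mx2 1 (y / w) 0 1), (mx2 1 0 (z / w) 1), (mx2 (x - y * z / w) 0 0 w); split.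
  - exact/upper_iwahori/le1.
  - exact/lower_iwahori/lt1.
  - by rewrite !mx2_mul; congr mx2; field.
  left; exists (x - y * z / w), w; split=> //; apply: contraNneq d0 => e.
  have -> : x * w - y * z = w * (x - y * z / w) by field.
  by rewrite e mulr0.
have [/andP[hx hw]|nz1] := boolP ((abs x <= abs z) && (abs w <= abs z)).
  have z0 : z != 0.
    apply: contraNneq d0 => z0; move: hx; rewrite z0 abs0 => hx.
    have /eqP -> : x == 0 by rewrite -abs_eq0 eq_le hx abs_ge0.
    by rewrite mulr0 mul0r subrr.
  exists (mx2 1 (x / z) 0 1), (mx2 1 (w / z) 0 1), (mx2 0 (y - x * w / z) z 0); split.
  - exact/upper_iwahori/le1.
  - exact/upper_iwahori/le1.
  - by rewrite !mx2_mul; congr mx2; field.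
  right; exists (y - x * w / z), z; split=> //; apply: contraNneq d0 => e.
  have -> : x * w - y * z = - z * (y - x * w / z) by field.
  by rewrite e mulr0.
have [/andP[hx hw]|ny1] := boolP ((abs x < abs y) && (abs w < abs y)).
  have y0 := nz _ _ hx.
  exists (mx2 1 0 (w / y) 1), (mx2 1 0 (x / y) 1), (mx2 0 y (z - w * x / y) 0); split.
  - exact/lower_iwahori/lt1.
  - exact/lower_iwahori/lt1.
  - by rewrite !mx2_mul; congr mx2; field.
  right; exists y, (z - w * x / y); split=> //; apply: contraNneq d0 => e.
  have -> : x * w - y * z = - y * (z - w * x / y) by field.
  by rewrite e mulr0.
rewrite !negb_and -!leNgt -!ltNge in nz1 ny1.
have [h|h] := leP (abs w) (abs x); [apply: pivx|apply: pivw].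
- by case/orP: nz1 => // h1; apply: lt_le_trans h1 h.
- by case/orP: ny1 => // h1; apply: le_trans h1 h.
- by case/orP: nz1 => // h1; apply: lt_trans h1 h.
- by case/orP: ny1 => // h1; apply: le_trans h1 (ltW h).
Qed.

Lemma chamber_std C : is_chamber p abs C ->
  exists h, [/\ h \in unitmx, rep (h *m E 0) C.1 & rep (h *m E 1) C.2].
Proof.
move=> [_ _ hC].
have [||h h0 r] := @path_std (fun k => if k is 0 then C.1 else C.2) 0 => //; first by case.
by exists h; split=> //; [apply: (r 0%N)|apply: (r 1%N)].
Qed.

(** In [bruhat], the outer factors fix the standard edge and the monomial factor moves it along the
    line: [s] is 1 for a diagonal factor, -1 for an antidiagonal one. *)
Lemma two_chambers C D : is_chamber p abs C -> is_chamber p abs D ->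
  exists h l s, [/\ h \in unitmx, s = 1 \/ s = -1, rep (h *m E 0) C.1 /\ rep (h *m E 1) C.2 &
    rep (h *m E l) D.1 /\ rep (h *m E (l + s)) D.2].
Proof.
move=> /chamber_std[h [h0 r1 r2]] /chamber_std[g [g0 r3 r4]].
have [|u [v [n [[hu ue] [hv ve] e nP]]]] := @bruhat (invmx h *m g).
  by rewrite unitmx_mul unitmx_inv h0.
have gE : g = h *m u *m n *m v.
  by rewrite -[g](mulKVmx h0) e !mulmxA.
have fin l s : s = 1 \/ s = -1 -> heq (E l) (n *m E 0) -> heq (E (l + s)) (n *m E 1) ->
    exists h l s, [/\ h \in unitmx, s = 1 \/ s = -1,
      rep (h *m E 0) C.1 /\ rep (h *m E 1) C.2 & rep (h *m E l) D.1 /\ rep (h *m E (l + s)) D.2].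
  move=> hs n0 n1; exists (h *m u), l, s; split=> //.
  - by rewrite unitmx_mul h0 GLO_unit.
  - split; first by apply: rep_heq r1; rewrite E0 !mulmx1; apply: heq_GLO.
    by apply: rep_heq r2; rewrite -mulmxA; apply: heq_mul.
  split.
    apply: rep_heq r3; rewrite gE -!mulmxA; do 2 apply: heq_mul.
    apply: heq_trans (heq_sym n0); apply: heq_mul.
    by rewrite E0 mulmx1; apply/heq_sym; rewrite -[v]mul1mx; apply: heq_GLO.
  apply: rep_heq r4; rewrite gE -!mulmxA; do 2 apply: heq_mul.
  by apply: heq_trans (heq_sym n1); apply: heq_mul; apply: heq_sym.
case: nP => [[x [w [nE x0 w0]]]|[y [z [nE y0 z0]]]].
  have [|k hk] := @abs_val (w / x); first by rewrite mulf_neq0 ?invr_neq0.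
  rewrite -[k]opprK in hk; have hd := diag_std x0 hk; rewrite -nE in hd.
  apply: (fin (0 + - k) 1); [by left|exact: hd|].
  by rewrite add0r addrC; apply: hd.
have [|k hk] := @abs_val (z / y); first by rewrite mulf_neq0 ?invr_neq0.
rewrite -[k]opprK in hk; have hd := anti_std y0 hk; rewrite -nE in hd.
apply: (fin (- k - 0) (-1)); [by right|exact: hd|].
by rewrite subr0; apply: hd.
Qed.

(** * Strong transitivity from a torus and a reflection *)

Lemma line_ch_eq f C D : ch_eq C D -> line f C -> line f D.
Proof.
move=> e [hC [k hk]]; split; first exact: is_chamber_eq e hC.
exists k; case: e hk => /homothetic_sym e1 /homothetic_sym e2 [] [h1 h2]; [left|right];
  by split; [apply: homothetic_trans h1|apply: homothetic_trans h2].
Qed.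

Lemma is_chamber_act x C : normone a b x -> is_chamber p abs C ->
  is_chamber p abs (actC iota phi x C).
Proof.
move=> nx [t1 t2 aC]; have x0 := gmat_unit nx; have dx : abs (\det (gm x)) = 1.
  by rewrite gmat_det1 ?abs1.
split; [exact: type0_mact t1| |exact: adjv_mact aC].
move=> t; apply: t2.
have : type0 abs (mact (invmx (gm x)) (mact (gm x) C.2)).
  by apply: type0_mact t; rewrite ?unitmx_inv ?det_inv ?absV ?dx ?invr1.
by apply: type0_hom; apply/homothetic_sym/mact_inv => //; apply: homothetic_refl.
Qed.

Lemma act_conj x L M : normone a b x -> homothetic (mact (gm x) L) M ->
  homothetic (mact (gm (qconj x)) M) L.
Proof.
move=> nx h; rewrite gmat_conj //; apply: homothetic_sym.
by apply: mact_inv => //; apply: gmat_unit.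
Qed.

(** Together with the inverse demanded in [line_act], only translations and reflections of the
    integers remain. *)
Definition unit_step (s : int -> int) := forall k, s (k + 1) = s k + 1 \/ s k = s (k + 1) + 1.

Lemma line_map x f f' s C : normone a b x -> unit_step s ->
  (forall k, homothetic (mact (gm x) (f k)) (f' (s k))) ->
  line f C -> line f' (actC iota phi x C).
Proof.
move=> nx hs h [hC [k hk]]; split; first exact: is_chamber_act.
have tr L l : homothetic L (f l) -> homothetic (actL iota phi x L) (f' (s l)).
  by move=> e; apply: homothetic_trans (mact_hom _ e) (h l).
case: hk => -[/tr h1 /tr h2]; case: (hs k) => e.
- by exists (s k); left; rewrite -e.
- by exists (s (k + 1)); right; rewrite -e.
- by exists (s k); right; rewrite -e.
- by exists (s (k + 1)); left; rewrite -e.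
Qed.

Lemma line_act x f f' s t C : normone a b x -> unit_step s -> unit_step t ->
  cancel t s ->
  (forall k, homothetic (mact (gm x) (f k)) (f' (s k))) ->
  line f C <-> line f' (actC iota phi x C).
Proof.
move=> nx hs ht st h; split; first exact: line_map h.
move=> /(line_map (s := t) (f' := f) (normone_conj nx) ht) l.
apply: line_ch_eq (l _) => [|k].
  by split; apply: act_conj => //; apply: homothetic_refl.
by apply: act_conj => //; rewrite -{2}[k]st; apply: h.
Qed.

Section Strong.
Variable h : 'M[K]_2.
Hypothesis h0 : h \in unitmx.
Hypothesis dh : \det h = 1.
Hypothesis translation : exists2 x, normone a b x &
  forall k, heq (h *m E (k + 2)) (gm x *m (h *m E k)).
Hypothesis reflection : exists2 x, normone a b x & exists m : int,
  forall k, heq (h *m E (m * 2 - k)) (gm x *m (h *m E k)).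

Let f k := lattice_of abs (h *m E k).

Let hE k : h *m E k \in unitmx. Proof. by rewrite unitmx_mul h0 E_unit. Qed.

Lemma translations m : exists2 x, normone a b x &
  forall k, heq (h *m E (k + m * 2)) (gm x *m (h *m E k)).
Proof.
have [x nx hx] := translation.
have nat_case (n : nat) : exists2 x, normone a b x &
    forall k, heq (h *m E (k + n%:Z * 2)) (gm x *m (h *m E k)).
  elim: n => [|n [y ny hy]].
    exists (qone rat); first exact: normone1.
    by move=> k; rewrite gmat1 mul1mx mul0r addr0; apply: heq_refl.
  exists (qmul a b x y); first exact: normone_mul.
  move=> k; rewrite gmatM -mulmxA; apply: heq_trans (heq_mul _ (hy k)).
  by rewrite (_ : k + n.+1%:Z * 2 = k + n%:Z * 2 + 2) //; lia.
case: (intP m) => [|n|n]; [exact: (nat_case 0%N)|exact: nat_case|].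
have [y ny hy] := nat_case n.+1; exists (qconj y); first exact: normone_conj.
move=> k; rewrite gmat_conj //; apply: heq_sym.
have := heq_mul (invmx (gm y)) (hy (k + - n.+1%:Z * 2)).
by rewrite mulKmx ?gmat_unit // (_ : _ + n.+1%:Z * 2 = k) //; lia.
Qed.

(** Composition with the translation by [(m - l) * 2] moves the centre of reflection from [l] to
    [m]. *)
Lemma reflections m : exists2 x, normone a b x &
  forall k, heq (h *m E (m * 2 - k)) (gm x *m (h *m E k)).
Proof.
have [x nx [l hx]] := reflection; have [y ny hy] := translations (m - l).
exists (qmul a b y x); first exact: normone_mul.
move=> k; rewrite gmatM -mulmxA; apply: heq_trans (heq_mul _ (hx k)).
have := hy (l * 2 - k); rewrite (_ : l * 2 - k + (m - l) * 2 = m * 2 - k) //; lia.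
Qed.

Let f_adj k : adjv p abs (f k) (f (k + 1)).
Proof. exact: adj_E. Qed.

Let f_inj k l : homothetic (f k) (f l) -> k = l.
Proof.
by move=> /homotheticP => /(_ (hE k) (hE l)) /(heq_mul (invmx h)); rewrite !mulKmx // => /heq_E.
Qed.

Lemma type0_std k : type0 abs (f k) -> exists m, k = m * 2.
Proof.
move=> /(type0P (hE k) (homothetic_refl _)) [m].
rewrite det_mulmx dh mul1r det_E abs_PX => /eq_prz e; exists (- m); lia.
Qed.

(** Type-0 vertices sit at even indices because [det h = 1]; a chamber is then given by such an
    index and a direction. *)
Lemma line_std x C : normone a b x -> line (fun k => mact (gm x) (f k)) C ->
  exists m s, [/\ s = 1 \/ s = -1, homothetic C.1 (mact (gm x) (f (m * 2))) &
    homothetic C.2 (mact (gm x) (f (m * 2 + s)))].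
Proof.
move=> nx [hC [k hk]]; have [tC _ _] := hC.
have ty l : homothetic C.1 (mact (gm x) (f l)) -> exists m, l = m * 2.
  move=> e; apply: type0_std.
  have nx' := normone_conj nx.
  have : type0 abs (mact (gm (qconj x)) (mact (gm x) (f l))).
    by apply: type0_mact (type0_hom e tC); rewrite ?gmat_unit ?gmat_det1 ?abs1.
  by apply: type0_hom; apply: act_conj => //; apply: homothetic_refl.
case: hk => -[h1 h2].
  by have [m e] := ty _ h1; exists m, 1; rewrite -e; split=> //; left.
have [m e] := ty _ h2; exists m, (-1); rewrite -e addrK; split=> //; right=> //.
Qed.

Lemma strongly_transitive_G : strongly_transitive_some a b p iota abs phi.
Proof.
exists (fun S => exists2 x, normone a b x & forall C, S C <-> line (fun k => mact (gm x) (f k)) C).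
split.
- split=> [S [x nx hS]|C D hC hD].
    exists (fun k => mact (gm x) (f k)); split=> //.
      by move=> k; apply: adjv_mact (f_adj k); apply: gmat_unit.
    by move=> k l /mact_inj-/(_ (gmat_unit nx))/f_inj.
  have [g [l [s [g0 hs [r1 r2] [r3 r4]]]]] := two_chambers hC hD.
  have [|||c c0 e] := @same_type h g (f 0) C.1 h0 g0.
  + by rewrite /f E0 mulmx1; apply: homothetic_refl.
  + by move: r1; rewrite E0 mulmx1.
  + split=> _; first by case: hC.
    apply/(type0P (hE 0) (homothetic_refl _)).
    by exists 0; rewrite E0 mulmx1 dh abs1.
  (* Only the vertices of [C] and [D] are matched; elsewhere the translate of [f] may leave the line
     of [g]. *)
  have [x [nx hx]] := approx_std [:: 0; 1; l; l + s] h0 g0 c0 e.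
  have rep_f k L : k \in [:: 0; 1; l; l + s] -> rep (g *m E k) L ->
      homothetic L (mact (gm x) (f k)).
    move=> hk r; apply: rep_inj r _; apply: rep_heq (heq_sym (hx k hk)) _.
    exact: mact_lattice.
  exists (line (fun k => mact (gm x) (f k))); split; first by exists x.
    split=> //; exists 0; left; split; apply: rep_f => //; rewrite !inE ?eqxx //.
  have e3 := rep_f _ _ _ r3; have e4 := rep_f _ _ _ r4.
  split=> //; case: hs e3 e4 => -> e3 e4.
    by exists l; left; split; [apply: e3|apply: e4]; rewrite !inE eqxx ?orbT.
  exists (l - 1); right; rewrite subrK.
  by split; [apply: e4|apply: e3]; rewrite !inE eqxx ?orbT.
- move=> y S ny [x nx hS]; exists (line (fun k => mact (gm (qmul a b y x)) (f k))).
  split; first by exists (qmul a b y x) => //; apply: normone_mul.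
  move=> C; rewrite hS; apply: (@line_act _ _ _ id id) => //; try by left.
  by move=> k; rewrite gmatM; apply/homothetic_sym/mact_comp.
move=> S1 C1 S2 C2 [x1 nx1 hS1] SC1 [x2 nx2 hS2] SC2.
have [m1 [s1 [hs1 e11 e12]]] := line_std nx1 ((hS1 _).1 SC1).
have [m2 [s2 [hs2 e21 e22]]] := line_std nx2 ((hS2 _).1 SC2).
have fin s t n : unit_step s -> unit_step t -> cancel t s -> normone a b n ->
    (forall k, heq (h *m E (s k)) (gm n *m (h *m E k))) ->
    s (m1 * 2) = m2 * 2 -> s (m1 * 2 + s1) = m2 * 2 + s2 ->
    exists x, [/\ normone a b x, (forall C, S1 C <-> S2 (actC iota phi x C)) &
                 ch_eq (actC iota phi x C1) C2].
  (* Return from [S1] to the base line by [x1^-1], adjust there by [n], go out to [S2] by [x2]. *)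
  move=> hs ht st nn hn sm1 sm2; pose x := qmul a b (qmul a b x2 n) (qconj x1).
  have nx : normone a b x.
    by apply: normone_mul; [apply: normone_mul|apply: normone_conj].
  have hx k : homothetic (mact (gm x) (mact (gm x1) (f k))) (mact (gm x2) (f (s k))).
    apply: homothetic_trans (homothetic_sym (mact_comp _ _ _)) _.
    rewrite !gmatM gmat_conj // mulmxKV ?gmat_unit //.
    apply: homothetic_trans (mact_comp _ _ _) _; apply: mact_hom.
    apply: homothetic_trans (homothetic_sym (mact_lattice _ _)) _.
    exact/heq_homothetic/heq_sym.
  exists x; split=> // [C|].
    by rewrite hS1 hS2; apply: (@line_act _ _ _ s t).
  have key C D k k' : homothetic C (mact (gm x1) (f k)) -> s k = k' ->
      homothetic D (mact (gm x2) (f k')) -> homothetic (mact (gm x) C) D.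
    move=> e <- e'; apply: homothetic_trans (mact_hom _ e) _.
    exact: homothetic_trans (hx k) (homothetic_sym e').
  by split; [apply: key e11 _ e21|apply: key e12 _ e22].
have [ss|ss] : s1 = s2 \/ s1 = - s2 by lia.
  have [n nn hn] := translations (m2 - m1).
  apply: (fin (fun k => k + (m2 - m1) * 2) (fun k => k - (m2 - m1) * 2) n) => //.
  + by move=> k; left; lia.
  + by move=> k; left; lia.
  + by move=> k; lia.
  + lia.
  + lia.
(* Opposite directions: the centre [m1 + m2] is the one whose reflection exchanges [m1 * 2] and
   [m2 * 2]. *)
have [n nn hn] := reflections (m1 + m2).
apply: (fin (fun k => (m1 + m2) * 2 - k) (fun k => (m1 + m2) * 2 - k) n) => //.
+ by move=> k; right; lia.
+ by move=> k; right; lia.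
+ by move=> k; lia.
+ lia.
+ lia.
Qed.

End Strong.

Lemma strongly_transitive_torus i y r : p != 2%N -> abs r = 1 -> normone a b i ->
  gm i *m gm i = - 1%:M -> gm i *m gm y = - (gm y *m gm i) ->
  gm y *m gm y = (r ^+ 2)%:M -> strongly_transitive_some a b p iota abs phi.
Proof.
move=> p2 r1 ni II IY YY.
have r0 : r != 0 by rewrite -abs_eq0 r1 oner_neq0.
have [h [t [dh t0 Yh Ih]]] := torus_frame two_neq0 r0 II IY YY.
have h0 : h \in unitmx by rewrite unitmxE dh unitr1.
apply: (strongly_transitive_G h0 dh); last first.
  (* The entries [- t] and [t^-1] have a ratio of even valuation, so the centre of the reflection is
     a vertex. *)
  have [m hm] := abs_val t0; exists i => //; exists m => k.
  rewrite mulmxA Ih -mulmxA; apply: heq_mul; apply: anti_std.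
    by rewrite oppr_eq0.
  by rewrite absM !absV absN hm invr_expz -expfzDr ?pr_neq0 //; congr (_ ^ _); lia.
have pV0 : 0 < p%:R^-1 :> rat by rewrite invr_gt0 pr_gt0.
(* Adding [p] to an approximation of [r] closer than [p^-1] makes the valuation of [A' - r] exactly
   1. *)
have [q hq] := abs_dense r pV0; set A := q + p%:R; set A' := iota A.
have hm : abs (A' - r) = p%:R^-1.
  rewrite /A' /A rmorphD rmorph_nat (_ : _ - r = P + - (r - iota q)).
    by rewrite absDl ?absN abs_P.
  by rewrite /P; ring.
have hp : abs (A' + r) = 1.
  have e2 : abs (2%:R * r) = 1 by rewrite absM abs_two // r1 mulr1.
  rewrite (_ : A' + r = 2%:R * r + (A' - r)); last by ring.
  by rewrite absDl e2 // hm invf_lt1 ?pr_gt0 // pr_gt1.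
have m0 : A' - r != 0 by rewrite -abs_eq0 hm gt_eqF.
have p0 : A' + r != 0 by rewrite -abs_eq0 hp oner_neq0.
(* [z^2 / N(z)] is [z / zbar]; as [v(A' - r) = 1] and [v(A' + r) = 0], it translates the
   apartment of the torus by 2. *)
set z := qadd (qscale A (qone rat)) y.
have zh : gm z *m h = h *m mx2 (A' + r) 0 0 (A' - r).
  rewrite gmatD gmatZ gmat1 mulmxDl Yh -scalemxAl mul1mx -mul_mx_scalar -mulmxDr.
  by rewrite mx2_scalar mx2_add !addr0.
have dz : iota (qnorm a b z) = (A' + r) * (A' - r).
  have := congr1 (@determinant K 2) zh.
  by rewrite !det_mulmx dh mulr1 mul1r gmat_det det_mx2 mulr0 subr0.
have Nz : qnorm a b z != 0 by rewrite -(fmorph_eq0 iota) dz mulf_neq0.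
exists (qscale (qnorm a b z)^-1 (qmul a b z z)); first exact: normone_sqr.
move=> k; rewrite gmatZ gmatM fmorphV dz.
rewrite (_ : _ *m (h *m E k) = h *m (mx2 ((A' + r) / (A' - r)) 0 0 ((A' - r) / (A' + r)) *m E k)).
  apply/heq_mul/diag_std; first by rewrite mulf_neq0 ?invr_neq0.
  rewrite (_ : _ / _ = (A' - r) ^+ 2 / (A' + r) ^+ 2); last by field; rewrite ?m0 ?p0.
  by rewrite absM absV !absX hm hp expr1n divr1 exprVn exprnN.
set D := mx2 (A' + r) 0 0 (A' - r) in zh.
rewrite -scalemxAl [gm z *m gm z *m _]mulmxA -[gm z *m gm z *m h]mulmxA zh.
rewrite [gm z *m (h *m D)]mulmxA zh -!mulmxA scalemxAr; congr (_ *m _).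
rewrite !mulmxA scalemxAl /D mx2_mul mx2_scale; congr (mx2 _ _ _ _ *m _);
  by field; rewrite ?m0 ?p0.
Qed.

End Abs.

(** * Pure rational quaternions *)

Section RationalQuaternions.
Variables a b : rat.

(** If the scalar part were nonzero, the other coordinates would vanish and -1 would be a square of
    a rational. *)
Lemma sqrt_minus_one_pure x : qmul a b x x = qopp (qone rat) ->
  q1 x = 0 /\ normone a b x.
Proof.
case: x => x1 x2 x3 x4; rewrite /qmul /qopp /qone /normone /qnorm /= oppr0.
case=> e1 e2 e3 e4.
have x10 : x1 = 0.
  apply/eqP; apply: contraT => x10.
  have h z : x1 * z *+ 2 = 0 -> z = 0.
    by move/eqP; rewrite mulrn_eq0 mulf_eq0 (negPf x10) => /eqP.
  have z2 : x2 = 0 by apply: h; rewrite -[RHS]e2; ring.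
  have z3 : x3 = 0 by apply: h; rewrite -[RHS]e3; ring.
  have z4 : x4 = 0 by apply: h; rewrite -[RHS]e4; ring.
  move: e1; rewrite z2 z3 z4 !(mulr0, addr0, subr0) => e1.
  have := sqr_ge0 x1; rewrite expr2 e1; by [].
split=> //; move/(congr1 (@GRing.opp rat)): e1; rewrite opprK x10 => <-; ring.
Qed.

Lemma anticommuting x : a != 0 -> qmul a b x x = qopp (qone rat) ->
  exists2 y, y <> Quat 0 0 0 0 /\ q1 y = 0 & qmul a b x y = qopp (qmul a b y x).
Proof.
move=> a0 e; have [x10 nx] := sqrt_minus_one_pure e.
case: x e x10 nx => x1 x2 x3 x4 _ /= -> nx.
have [/andP[/eqP -> /eqP ->]|h] := boolP ((x3 == 0) && (x4 == 0)).
  exists (Quat 0 0 1 0); first by split=> // -[/eqP]; rewrite oner_eq0.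
  by rewrite /qmul /qopp /=; congr Quat; ring.
(* Half the commutator [x e2 - e2 x], which anticommutes with [x] because [x^2] is central; it
   vanishes only when [x] is a multiple of [e2]. *)
exists (Quat 0 0 (- a * x4) (- x3)).
  split=> // -[/eqP + /eqP]; rewrite mulf_eq0 !oppr_eq0 (negPf a0) /= => h4 h3.
  by rewrite h3 h4 in h.
by rewrite /qmul /qopp /=; congr Quat; ring.
Qed.

Lemma pure_sqr x : q1 x = 0 -> qmul a b x x = qscale (- qnorm a b x) (qone rat).
Proof. by case: x => ? ? ? ? /= ->; rewrite /qmul /qscale /qnorm /=; congr Quat; ring. Qed.

Lemma qnorm_mul x y : qnorm a b (qmul a b x y) = qnorm a b x * qnorm a b y.
Proof. by rewrite /qmul /qnorm /=; ring. Qed.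

Lemma division_qnorm x : is_division a b -> x <> Quat 0 0 0 0 -> qnorm a b x != 0.
Proof.
move=> hdiv /hdiv[y [e _]]; apply/eqP => x0; have := qnorm_mul x y.
have n1 : qnorm a b (qone rat) = 1 by rewrite /qnorm /=; ring.
by rewrite e x0 mul0r n1 => /eqP; rewrite oner_eq0.
Qed.

End RationalQuaternions.

(** * Good primes and the dichotomy *)

Lemma split_Qp a b p (K : fieldType) (iota : {rmorphism rat -> K}) abs :
  a != 0 -> b != 0 -> prime p -> p != 2%N -> punit p a -> punit p b ->
  is_Qp p iota abs -> exists phi, splitting_iso a b iota phi.
Proof.
move=> a0 b0 p_pr p2 pa pb HQ.
have [x [y [r [e r1]]]] := conic_Qp p_pr HQ p2 pa pb.
have r0 : r != 0 by rewrite -(abs_eq0 HQ) r1 oner_neq0.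
apply: (@split_quat _ (two_neq0 iota) _ _ (iota x / r) (iota y / r)); rewrite ?fmorph_eq0 //.
have {}e : iota a * iota x ^+ 2 + iota b * iota y ^+ 2 = r ^+ 2.
  by rewrite -e !expr2 rmorphD !rmorphM.
rewrite (_ : _ + _ = (iota a * iota x ^+ 2 + iota b * iota y ^+ 2) / r ^+ 2); last by field.
by rewrite e divff // expf_neq0.
Qed.

Definition bad_primes (q : rat) := primes (`|numq q| * `|denq q|).

Lemma punitP p q : prime p -> q != 0 -> p \notin bad_primes q -> punit p q.
Proof.
move=> p_pr q0; rewrite mem_primes p_pr /= muln_gt0 !absz_gt0 numq_eq0 q0 denq_neq0 /=.
by rewrite Euclid_dvdM // negb_or.
Qed.

Theorem theorem1 (a b : rat) :
  a != 0 -> b != 0 -> is_division a b ->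
  (sqrt_minus_one a b /\
   almost_all_p a b (fun p K iota abs phi =>
     strongly_transitive_some a b p iota abs phi))
  \/
  (~ sqrt_minus_one a b /\
   almost_all_p a b (fun p K iota abs phi =>
     weyl_transitive a b p iota abs phi /\
     ~ strongly_transitive_some a b p iota abs phi)).
Proof.
move=> a0 b0 hdiv; case: (classic (sqrt_minus_one a b)) => [h|h]; [left|right]; split=> //.
  have [i ii] := h; have [_ ni] := sqrt_minus_one_pure ii.
  have [j [j0 jp] ij] := anticommuting a0 ii.
  (* [c] is [j^2]; it is nonzero because the algebra is a division algebra. *)
  have Nj := division_qnorm hdiv j0; set c := - qnorm a b j.
  have c0 : c != 0 by rewrite oppr_eq0.
  exists (2%N :: bad_primes a ++ bad_primes b ++ bad_primes c) => p p_pr.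
  rewrite inE !mem_cat !negb_or => /and4P[p2 pa pb pc] K iota abs HQ.
  have [pua pub puc] := And3 (punitP p_pr a0 pa) (punitP p_pr b0 pb) (punitP p_pr c0 pc).
  split; first exact: split_Qp pua pub HQ.
  (* Both coefficients of the conic are [c], since [(i j)^2 = j^2 = c]; thus [r^2] is the square of
     [x j + y i j]. *)
  move=> phi Hphi; have [x [y [r [e r1]]]] := conic_Qp p_pr HQ p2 puc puc.
  set I := gmat iota phi i; set J := gmat iota phi j.
  have II : I *m I = - 1%:M.
    rewrite -(gmatM Hphi) ii (_ : qopp _ = qscale (-1) (qone rat)).
      by rewrite (gmatZ Hphi) (gmat1 Hphi) rmorphN1 scaleN1r.
    by rewrite /qopp /qscale /=; congr Quat; rewrite ?mulr0 ?mulr1 ?oppr0.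
  have IJ : J *m I = - (I *m J).
    rewrite -!(gmatM Hphi) ij (_ : qopp _ = qscale (-1) (qmul a b j i)).
      by rewrite (gmatZ Hphi) rmorphN1 scaleN1r opprK.
    by rewrite /qopp /qscale /= !mulN1r.
  have JJ : J *m J = iota c *: 1%:M.
    by rewrite -(gmatM Hphi) pure_sqr // (gmatZ Hphi) (gmat1 Hphi).
  have KK : (I *m J) *m (I *m J) = J *m J.
    by rewrite -mulmxA [J *m (I *m J)]mulmxA IJ mulNmx mulmxN !mulmxA II !mulNmx mul1mx opprK.
  apply: (strongly_transitive_torus p_pr HQ Hphi (i := i)
    (y := qadd (qscale x j) (qscale y (qmul a b i j))) p2 r1 ni) => //.
    rewrite !(gmatD Hphi) !(gmatZ Hphi) !(gmatM Hphi) -/I -/J.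
    rewrite mulmxDr mulmxDl -!scalemxAr -!scalemxAl IJ -[I *m J *m I]mulmxA IJ.
    by rewrite mulmxN opprD !scalerN !opprK.
  rewrite !(gmatD Hphi) !(gmatZ Hphi) !(gmatM Hphi) -/I -/J.
  rewrite mulmxDl !mulmxDr -!scalemxAr -!scalemxAl KK [J *m (I *m J)]mulmxA IJ mulNmx JJ.
  rewrite -[I *m J *m J]mulmxA JJ.
  set T := I *m _; rewrite !scalerN !scalerA [iota y * iota x]mulrC addrA subrK.
  rewrite -scalerDl scalemx1 -e; congr _%:M.
  by rewrite !expr2 rmorphD !rmorphM; ring.
exists (2%N :: bad_primes a ++ bad_primes b) => p p_pr.
rewrite inE !mem_cat !negb_or => /and3P[p2 pa pb] K iota abs HQ; split.
  exact: split_Qp (punitP p_pr a0 pa) (punitP p_pr b0 pb) HQ.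
move=> phi Hphi; split; first exact: (weyl_transitive_G p_pr HQ Hphi).
by move=> /(not_strongly_transitive p_pr HQ Hphi).
Qed.
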